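(* For every real $k\ge2$ there exists a computable constant $C(k)$ such that for every integer $n>C(k)$ there are two distinct primes $p,q$ with $\frac{k-1}{k}n<p,q<\frac{k}{k-1}n$. *)

(* Defs.v *)
From mathcomp Require Import all_boot all_order all_algebra.
From mathcomp Require Import all_reals.

Set Implicit Arguments.
Unset Strict Implicit.
Unset Printing Implicit Defensive.

Import Order.TTheory GRing.Theory Num.Theory.
Local Open Scope ring_scope.

(* Partial recursive functions relative to an oracle phi : nat -> nat, written
   as expressions over an environment of natural numbers (de Bruijn indices).
   [OLet a b] binds the value of [a] in [b] and thus provides composition;
   in [ORec m a s] the step [s] sees the previous value as variable 0 and the
   loop counter as variable 1; [OMu a] is unbounded minimization over
   variable 0 of [a]. *)
Inductive oexpr : Type :=
| OZero
| OVar of nat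
| OSucc of oexpr
| OQuery of oexpr
| OLet of oexpr & oexpr
| ORec of oexpr & oexpr & oexpr
| OMu of oexpr.

(* [oeval phi xs e v]: with oracle phi, in environment xs, the evaluation of e
   halts with value v. *)
Inductive oeval (phi : nat -> nat) : seq nat -> oexpr -> nat -> Prop :=
| oeval_zero xs : oeval phi xs OZero 0%N
| oeval_var xs i : oeval phi xs (OVar i) (nth 0%N xs i)
| oeval_succ xs a v : oeval phi xs a v -> oeval phi xs (OSucc a) v.+1
| oeval_query xs a v : oeval phi xs a v -> oeval phi xs (OQuery a) (phi v)
| oeval_let xs a b u v :
    oeval phi xs a u -> oeval phi (u :: xs) b v -> oeval phi xs (OLet a b) v
| oeval_rec xs m a s l (u : nat -> nat) :
    oeval phi xs m l -> oeval phi xs a (u 0%N) ->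
    (forall i : nat, (i < l)%N -> oeval phi [:: u i, i & xs] s (u i.+1)) ->
    oeval phi xs (ORec m a s) (u l)
| oeval_mu xs a l (w : nat -> nat) :
    (forall i : nat, (i < l)%N -> oeval phi (i :: xs) a (w i).+1) ->
    oeval phi (l :: xs) a 0%N ->
    oeval phi xs (OMu a) l.

(* The bijection 0, 1, 2, 3, 4, ... |-> 0, -1, 1, -2, 2, ... *)
Definition int_decode (m : nat) : int :=
  if odd m then Negz m./2 else Posz m./2.

(* phi lists (coded numerators of) dyadic approximations of x, the i-th one
   having denominator 2 ^ i and error at most 2 ^ -i. *)
Definition real_name (R : realType) (phi : nat -> nat) (x : R) : Prop :=
  forall i : nat, `|x - (int_decode (phi i))%:~R / 2 ^+ i| <= 2 ^- i.

(* Computability of a real function in the usual sense of computable analysis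
   (Grzegorczyk, Ko, Weihrauch): one algorithm turns every name of a point x
   of D, given as an oracle, into a name of f x. *)
Definition computable_on (R : realType) (D : {pred R}) (f : R -> R) : Prop :=
  exists e : oexpr,
    forall (x : R) (phi : nat -> nat), x \in D -> real_name phi x ->
    exists psi : nat -> nat,
      real_name psi (f x) /\ forall j : nat, oeval phi [:: j] e (psi j).

(* Main.v *)
(** Selberg's formula
      psi(N) ln N + sum_(k <= N) Lambda(k) psi(N/k) = 2 N ln N + O(N)
    bounds psi from above by twice its expected density on every short interval.
    If psi hardly grows on (N, N'] with N' = (1+c)N, the formula forces
    psi(N'/m) - psi(N/m) to be close to this maximal value 2(N'-N)/m for most m,
    in the sense of the weights Lambda(m)/m.  If moreover every interval
    (a, (1+c_+)a], with c_+ slightly larger than c, carries its share of primes, such m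
    form a chain m_0 < m_1 < ... of ratios at most 1 + 1.01c over a long range, and the
    intervals between the N/m_i add up to psi(y) >= 1.86 y, against Chebyshev's
    psi(y) <= 1.75 y.  Starting from a large c supplied by Mertens' theorem, one can
    therefore decrease c geometrically (this is Erdos' argument, made quantitative):
    the logarithm B of the threshold becomes at most K B^4 at each step.  Hence for
    c = 1/m a threshold E^(E^(E^m)) suffices for a suitable constant E, and C is an
    interpolation of these thresholds that is computable from a name of k. *)

Require Import Defs.
From mathcomp Require Import all_boot all_order all_algebra.
From mathcomp Require Import all_reals.
From mathcomp Require Import classical_sets sequences exp.
From mathcomp Require Import ring lra zify.

Set Implicit Arguments.
Unset Strict Implicit.
Unset Printing Implicit Defensive.

Import Order.TTheory GRing.Theory Num.Theory.
Local Open Scope ring_scope.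

(** * Divisor sums and the von Mangoldt and Moebius functions *)

(** The induction cannot merely assert that longer intervals contain primes. The average over m is
    weighted by Lambda, so an interval without suitable m contradicts it only if the interval has a
    definite Lambda-mass; hence [psi_dense] bounds increments of [psi] from below, and prime powers
    are discarded only at the very end. The reduction of c must also be uniform: [theta] and [K]
    depend only on the initial length, so a multiple of m reductions brings c below 1/(8m). (About
    ln m would do; the linear count keeps the exponents simple.) After j reductions B is q^(5^j),
    which is doubly exponential in m, and the threshold exp B supplies the third exponential. *)

Section DivisorSums.
Variable V : nmodType.

Lemma sum_multiples (N d : nat) (F : nat -> V) : (0 < d)%N ->
  \sum_(1 <= k < N.+1 | (d %| k)%N) F (k %/ d)%N
  = \sum_(1 <= n < (N %/ d).+1) F n.
Proof.
move=> d0; elim: N => [|N IH]; first by rewrite div0n !big_geq.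
rewrite big_mkcond big_nat_recr //= -big_mkcond /= {}IH divnS //.
case: ifP => [dN|_]; last by rewrite addr0 add0n.
by rewrite add1n [RHS]big_nat_recr //= dN.
Qed.

Lemma sum_divisors_widen (k N : nat) (F : nat -> V) : (0 < k <= N)%N ->
  \sum_(1 <= d < k.+1 | (d %| k)%N) F d = \sum_(1 <= d < N.+1 | (d %| k)%N) F d.
Proof.
move=> /andP[k0 kN]; rewrite (@big_nat_widen _ _ _ _ _ N.+1) //.
apply: eq_bigl => d; case: (boolP (d %| k)%N) => //= dk.
by rewrite ltnS dvdn_leq.
Qed.

Lemma sum_dirichlet (N : nat) (g : nat -> nat -> V) :
  \sum_(1 <= k < N.+1) \sum_(1 <= d < k.+1 | (d %| k)%N) g d (k %/ d)%N
  = \sum_(1 <= d < N.+1) \sum_(1 <= n < (N %/ d).+1) g d n.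
Proof.
transitivity (\sum_(1 <= k < N.+1) \sum_(1 <= d < N.+1 | (d %| k)%N) g d (k %/ d)%N).
  apply: eq_big_nat => k; rewrite ltnS => kN.
  by rewrite (sum_divisors_widen (fun d => g d (k %/ d)%N) kN).
rewrite (exchange_big_dep xpredT) //=.
by apply: eq_big_nat => d /andP[d0 _]; rewrite sum_multiples.
Qed.

Lemma sum_dvd_single (m n : nat) (F : nat -> V) : (0 < m)%N -> (m <= n)%N ->
  \sum_(1 <= d < n.+1 | d == m) F d = F m.
Proof.
move=> m0 mn; rewrite big_mkcond (bigD1_seq m) /= ?mem_index_iota ?iota_uniq //; last first.
  by rewrite m0 ltnS.
by rewrite eqxx big1 ?addr0 // => i /negbTE ->.
Qed.

End DivisorSums.

Section Mangoldt.
Variable R : realType.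
Local Open Scope nat_scope.

Definition Mangoldt (n : nat) : R :=
  if size (primes n) == 1 then ln (pdiv n)%:R else 0%R.

Lemma Mangoldt_prime_power (n : nat) : Mangoldt n != 0%R ->
  exists p k, [/\ prime p, 0 < k, n = p ^ k & Mangoldt n = ln p%:R].
Proof.
rewrite /Mangoldt; case: ifP; last by rewrite eqxx.
case E: (primes n) => [//|q [|//]] _ _.
have q_in : q \in primes n by rewrite E inE.
move: (q_in); rewrite mem_primes => /and3P[pq n0 qn].
have /p_natP[k nk] : q.-nat n.
  by apply/pnatP => // p pp pn; move: (mem_primes p n); rewrite E inE pp n0 pn.
have k0 : 0 < k by case: k nk n0 qn => // ->; rewrite expn0 dvdn1 => _ /eqP q1; rewrite q1 in pq.
by exists q, k; split => //; rewrite nk -(prednK k0) pdiv_pfactor.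
Qed.

Lemma Mangoldt_pow (p k : nat) : prime p -> 0 < k -> Mangoldt (p ^ k) = ln p%:R.
Proof.
move=> pp k0; rewrite /Mangoldt primesX // primes_prime //= -(prednK k0).
by rewrite pdiv_pfactor.
Qed.

Lemma Mangoldt_ge0 (n : nat) : (0 <= Mangoldt n)%R.
Proof.
rewrite /Mangoldt; case: ifP => // _; apply: ln_ge0.
by rewrite ler1n pdiv_gt0.
Qed.

Lemma Mangoldt_le_ln (n : nat) : (Mangoldt n <= ln n%:R)%R.
Proof.
case: n => [|n]; first by rewrite /Mangoldt /= ln0.
have n0 : (0 <= ln (n.+1%:R : R))%R by apply: ln_ge0; rewrite ler1n.
rewrite /Mangoldt; case: ifP => // _.
by rewrite ler_ln ?posrE ?ltr0n ?pdiv_gt0 // ler_nat pdiv_leq.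
Qed.

(** Induction on n = p m with p the least prime factor: the divisors of n that do not divide m
    contain the full power of p, so the only prime power among them is [p ^ logn p n], which
    contributes ln p. *)
Lemma sum_Mangoldt_divisors (n : nat) : 0 < n ->
  (\sum_(1 <= d < n.+1 | (d %| n)%N) Mangoldt d = ln n%:R)%R.
Proof.
elim/ltn_ind: n => n IH n0.
have [n1|n1] := leqP n 1.
  have -> : n = 1 by lia.
  by rewrite ln1 big_mkcond big_nat1 /Mangoldt.
set p := pdiv n; have pp : prime p by apply: pdiv_prime.
have p1 := prime_gt1 pp.
have [m nE] : exists m, n = p * m by exists (n %/ p); rewrite mulnC divnK // pdiv_dvd.
have m0 : 0 < m by case: (m) nE n0 => // ->; rewrite muln0.
have mn : m < n by rewrite nE; nia.
rewrite (bigID (fun d => d %| m)) /=.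
have -> : (\sum_(1 <= d < n.+1 | ((d %| n) && (d %| m))%N) Mangoldt d)%R = ln m%:R.
  rewrite -(IH m mn m0) (@sum_divisors_widen _ m n) ?m0 1?ltnW //.
  apply: eq_bigl => d; case: (boolP (d %| m)); rewrite ?andbF // andbT => dm.
  by rewrite nE dvdn_mull.
have lE : logn p n = (logn p m).+1 by rewrite nE lognM // ?prime_gt0 // logn_prime // eqxx.
rewrite (bigID (fun d => d == p ^ logn p n)) /= [X in (_ + (_ + X))%R]big1; last first.
  move=> d /andP[/andP[dn ndm] dp]; apply: contraNeq dp => /Mangoldt_prime_power.
  move=> [q [k [pq k0 dE _]]]; have [qp|qp] := eqVneq q p; last first.
    case/negP: ndm; move: dn; rewrite nE dE Gauss_dvdr // coprimeXl //.
    by rewrite prime_coprime // dvdn_prime2.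
  rewrite dE qp eqn_exp2l //; move: dn ndm; rewrite dE qp.
  by rewrite !pfactor_dvdn // lE; lia.
have -> : (\sum_(1 <= i < n.+1 | ((i %| n) && ~~ (i %| m) && (i == p ^ logn p n))%N) Mangoldt i
  = \sum_(1 <= i < n.+1 | (i == p ^ logn p n)%N) Mangoldt i)%R.
  apply: eq_bigl => d; case: eqP => [->|]; rewrite ?andbF // andbT.
  by rewrite pfactor_dvdnn pfactor_dvdn // lE ltnn.
have pv0 : 0 < p ^ logn p n by rewrite expn_gt0 prime_gt0.
have pvn : p ^ logn p n <= n by rewrite dvdn_leq ?pfactor_dvdnn.
rewrite (sum_dvd_single _ pv0 pvn) Mangoldt_pow ?lE // addr0 nE natrM addrC.
by rewrite lnM ?posrE ?ltr0n ?m0 // prime_gt0.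
Qed.

End Mangoldt.

Section Moebius.
Variable R : realType.

Definition Moebius (n : nat) : R :=
  if all (fun p => logn p n == 1%N) (primes n) then (-1) ^+ size (primes n) else 0.

Lemma Moebius_norm (n : nat) : `|Moebius n| <= 1.
Proof. by rewrite /Moebius; case: ifP; rewrite ?normr0 // normrX normrN1 expr1n. Qed.

Lemma Moebius_mul_prime (p n : nat) : prime p -> (0 < n)%N -> ~~ (p %| n)%N ->
  Moebius (p * n) = - Moebius n.
Proof.
move=> pp n0 pn; have p0 := prime_gt0 pp.
have pr : perm_eq (primes (p * n)) (p :: primes n).
  apply: uniq_perm; rewrite ?primes_uniq //=.
    by rewrite primes_uniq andbT mem_primes pp n0.
  by move=> q; rewrite primesM // primes_prime // !inE.
rewrite /Moebius (perm_all _ pr) (perm_size pr) /= lognM // logn_prime // eqxx.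
have -> : logn p n = 0%N.
  by apply/eqP; rewrite -leqn0 leqNgt logn_gt0 mem_primes pp n0.
rewrite addn0 /=.
have -> : all (fun q => logn q (p * n) == 1%N) (primes n)
        = all (fun q => logn q n == 1%N) (primes n).
  apply: eq_in_all => q; rewrite mem_primes => /and3P[pq _ qn].
  rewrite lognM // logn_prime //.
  by have [qp|_ //] := eqVneq q p; rewrite -qp qn in pn.
by case: ifP => _; rewrite ?oppr0 // exprS mulN1r.
Qed.

Lemma Moebius_square (p n : nat) : prime p -> (0 < n)%N -> (p %| n)%N ->
  Moebius (p * n) = 0.
Proof.
move=> pp n0 pn; have p0 := prime_gt0 pp.
rewrite /Moebius; case: allP => // /(_ p).
rewrite mem_primes pp muln_gt0 n0 p0 dvdn_mulr //= => /(_ isT).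
rewrite lognM // logn_prime // eqxx.
have : (0 < logn p n)%N by rewrite logn_gt0 mem_primes pp n0.
by case: (logn p n).
Qed.

(** For n = p m the divisors d of m are paired with p d: the two values cancel if p does not divide
    d; otherwise the value at p d vanishes, and d itself is counted among the multiples of p. *)
Lemma sum_Moebius_divisors (n : nat) : (0 < n)%N ->
  \sum_(1 <= d < n.+1 | (d %| n)%N) Moebius d = (n == 1%N)%:R.
Proof.
move=> n0; have [n1|n1] := leqP n 1.
  have -> : n = 1%N by lia.
  by rewrite big_mkcond big_nat1 /Moebius.
set p := pdiv n; have pp : prime p by apply: pdiv_prime.
have p1 := prime_gt1 pp.
have [m nE] : exists m, n = (p * m)%N.
  by exists (n %/ p)%N; rewrite mulnC divnK // pdiv_dvd.
have m0 : (0 < m)%N by case: (m) nE n0 => // ->; rewrite muln0.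
have -> : (n == 1%N) = false by lia.
rewrite (bigID (fun d => (p %| d)%N)) /=.
have -> : \sum_(1 <= d < n.+1 | (d %| n)%N && (p %| d)%N) Moebius d
        = \sum_(1 <= d < n.+1 | (p %| d)%N)
            (if (p * (d %/ p) %| n)%N then Moebius (p * (d %/ p)) else 0).
  rewrite big_mkcond [RHS]big_mkcond; apply: eq_bigr => d _.
  case: (boolP (p %| d)%N) => pd; rewrite ?andbF // andbT.
  by rewrite mulnC divnK.
rewrite (sum_multiples n (fun e => if (p * e %| n)%N then Moebius (p * e) else 0)) ?prime_gt0 //.
rewrite {1}nE mulKn ?prime_gt0 // addrC.
have -> : \sum_(1 <= d < n.+1 | (d %| n)%N && ~~ (p %| d)%N) Moebius d
        = \sum_(1 <= d < n.+1 | (d %| m)%N) (if (p %| d)%N then 0 else Moebius d).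
  rewrite big_mkcond [RHS]big_mkcond; apply: eq_bigr => d _ /=.
  case: (boolP (p %| d)%N) => pd /=; rewrite ?andbF ?if_same // andbT.
  by rewrite nE Gauss_dvdr // coprime_sym prime_coprime.
rewrite -(@sum_divisors_widen _ m n) ?m0 /=; last by rewrite nE; nia.
rewrite [X in X + _]big_mkcond -big_split big_nat_cond big1 // => d /andP[/andP[d0 _] _] /=.
rewrite nE dvdn_pmul2l ?prime_gt0 //; case: ifP => _; rewrite ?addr0 //.
case: ifP => pd; first by rewrite Moebius_square ?add0r.
by rewrite Moebius_mul_prime ?pd // addrN.
Qed.

End Moebius.

(** * Chebyshev's bound *)

Section DoubleSums.
Variable V : nmodType.

Lemma sum_hyperbola_sym (N : nat) (h : nat -> nat -> V) :
  \sum_(1 <= d < N.+1) \sum_(1 <= n < (N %/ d).+1) h d n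
  = \sum_(1 <= n < N.+1) \sum_(1 <= d < (N %/ n).+1) h d n.
Proof.
have E (g : nat -> nat -> V) :
    \sum_(1 <= d < N.+1) \sum_(1 <= n < (N %/ d).+1) g d n
    = \sum_(1 <= d < N.+1) \sum_(1 <= n < N.+1 | (d * n <= N)%N) g d n.
  apply: eq_big_nat => d /andP[d0 _].
  rewrite (@big_nat_widen _ _ _ _ _ N.+1) ?ltnS ?leq_div //.
  by apply: eq_bigl => n; rewrite ltnS leq_divRL // mulnC.
rewrite E (E (fun n d => h d n)) (exchange_big_dep xpredT) //=.
by apply: eq_big_nat => n _; apply: eq_bigl => d; rewrite mulnC.
Qed.

Lemma sum_divisors_sym (k : nat) (h : nat -> nat -> V) : (0 < k)%N ->
  \sum_(1 <= d < k.+1 | (d %| k)%N) \sum_(1 <= e < (k %/ d).+1 | (e %| k %/ d)%N) h d e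
  = \sum_(1 <= e < k.+1 | (e %| k)%N) \sum_(1 <= d < (k %/ e).+1 | (d %| k %/ e)%N) h d e.
Proof.
move=> k0.
have E (g : nat -> nat -> V) :
  \sum_(1 <= d < k.+1 | (d %| k)%N) \sum_(1 <= e < (k %/ d).+1 | (e %| k %/ d)%N) g d e
  = \sum_(1 <= d < k.+1) \sum_(1 <= e < k.+1 | (d * e %| k)%N) g d e.
  rewrite big_mkcond; apply: eq_big_nat => d /andP[d0 _].
  case: ifP => dk; last first.
    by rewrite big1 // => e de; move: dk; rewrite (dvdn_trans _ de) // dvdn_mulr.
  have kd : (0 < k %/ d <= k)%N by rewrite leq_div divn_gt0 // dvdn_leq.
  rewrite (sum_divisors_widen _ kd).
  by apply: eq_bigl => e; rewrite dvdn_divRL // mulnC.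
rewrite E (E (fun e d => h d e)) (exchange_big_dep xpredT) //=.
by apply: eq_big_nat => e _; apply: eq_bigl => d; rewrite mulnC.
Qed.

End DoubleSums.

Section LogBounds.
Variable R : realType.
Implicit Types (N : nat) (x y : R).

Lemma ln_le_sub1 x : 0 < x -> ln x <= x - 1.
Proof.
move=> x0; have := @le_ln1Dx R (x - 1).
have -> : 1 + (x - 1) = x by ring.
by apply; lra.
Qed.

Lemma ln_succ_bounds N : (0 < N)%N ->
  N.+1%:R^-1 <= ln (N.+1%:R : R) - ln N%:R <= N%:R^-1.
Proof.
move=> N0; have n0 : 0 < N%:R :> R by rewrite ltr0n.
have n1 : 0 < N.+1%:R :> R by rewrite ltr0n.
have nE : N.+1%:R = N%:R + 1 :> R by rewrite -addn1 natrD.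
apply/andP; split.
  have := @ln_le_sub1 (N%:R / N.+1%:R) (divr_gt0 n0 n1).
  rewrite ln_div ?posrE // => H.
  have E : N.+1%:R^-1 = 1 - N%:R / N.+1%:R :> R by rewrite nE; field; lra.
  by rewrite E -(opprB (_ / _)) -[leRHS]opprB lerN2.
have := @ln_le_sub1 (N.+1%:R / N%:R) (divr_gt0 n1 n0).
rewrite ln_div ?posrE // => H.
have E : N%:R^-1 = N.+1%:R / N%:R - 1 :> R by rewrite nE; field; lra.
by rewrite E.
Qed.

Lemma ln2_bounds : 1 / 2 <= ln (2 : R) <= 3 / 4.
Proof.
apply/andP; split.
  by have /andP[+ _] := @ln_succ_bounds 1 isT; rewrite ln1 subr0; apply: le_trans; lra.
(* Since 8 * (3/32) = 3/4, the bound ln (1 + x) <= x then suffices. The eighth power is reached by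
   three squarings, rounded down to 1.196 and 1.43. *)
have two_le : 2 <= (1 + 3 / 32 : R) ^+ 8.
  have s (a b c : R) (n : nat) : 0 <= b -> a <= b * b -> b <= c ^+ n -> a <= c ^+ (n * 2).
    by move=> b0 ab bc; rewrite exprM expr2 (le_trans ab) // ler_pM.
  apply: (s _ (143 / 100) _ 4%N); [lra|lra|].
  apply: (s _ (1196 / 1000) _ 2%N); [lra|lra|].
  by apply: (s _ (1 + 3 / 32) _ 1%N); [lra|lra|rewrite expr1].
apply: (@le_trans _ _ (ln ((1 + 3 / 32 : R) ^+ 8))).
  by rewrite ler_ln ?posrE ?exprn_gt0 //; lra.
rewrite lnXn; last lra.
have H : ln (1 + 3 / 32) <= 3 / 32 :> R by apply: le_ln1Dx; lra.
by rewrite -[_ *+ 8]mulr_natl; lra.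
Qed.

End LogBounds.

Section Chebyshev.
Variable R : realType.
Implicit Types (M N n d k : nat) (x y : R).

Local Notation Lam := (Mangoldt R).

Definition psi N : R := \sum_(1 <= n < N.+1) Lam n.
Definition ln_fact N : R := \sum_(1 <= k < N.+1) ln k%:R.

Lemma psiS N : psi N.+1 = psi N + Lam N.+1.
Proof. by rewrite /psi big_nat_recr. Qed.

Lemma psi_le M N : (M <= N)%N -> psi M <= psi N.
Proof.
move=> MN; rewrite -(subnKC MN); elim: (N - M)%N => [|k IH]; first by rewrite addn0.
by rewrite addnS psiS (le_trans IH) // lerDl Mangoldt_ge0.
Qed.

Lemma psi_ge0 N : 0 <= psi N.
Proof. by apply: sumr_ge0 => n _; apply: Mangoldt_ge0. Qed.

Lemma ln_fact_psi N : ln_fact N = \sum_(1 <= n < N.+1) psi (N %/ n).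
Proof.
rewrite /ln_fact /psi -(sum_hyperbola_sym N (fun d _ => Lam d)) -sum_dirichlet.
by apply: eq_big_nat => k /andP[k0 _]; rewrite sum_Mangoldt_divisors.
Qed.

Lemma ln_fact_Mangoldt N : ln_fact N = \sum_(1 <= d < N.+1) Lam d * (N %/ d)%:R.
Proof.
rewrite ln_fact_psi /psi -(sum_hyperbola_sym N (fun d _ => Lam d)).
by apply: eq_bigr => d _; rewrite big_const_nat subn1 iter_addr_0 mulr_natr.
Qed.

(** The left side is the logarithm of the central binomial coefficient; passing from M to M + 1
    multiplies that coefficient by (2M+1)(2M+2)/(M+1)^2 <= 4. *)
Lemma ln_fact_double M : ln_fact M.*2 - 2 * ln_fact M <= M%:R * (2 * ln 2).
Proof.
elim: M => [|M IH]; first by rewrite /ln_fact !big_geq // mulr0 subr0 mul0r.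
rewrite doubleS /ln_fact !(big_nat_recr _.+2) //= !(big_nat_recr _.+1) //=.
rewrite -!/(ln_fact _).
have E : M.*2.+2%:R = 2 * M.+1%:R :> R by rewrite -natrM; congr (_%:R); lia.
have m0 : 0 < M.+1%:R :> R by rewrite ltr0n.
have lt1 : ln (M.*2.+1%:R : R) <= ln (M.*2.+2%:R).
  by rewrite ler_ln ?posrE ?ltr0n // ler_nat.
move: lt1; rewrite E lnM ?posrE //.
by rewrite -[in leRHS]natr1; move: IH; lra.
Qed.

(** In the logarithm of the central binomial coefficient, Lambda d has the coefficient floor(2M/d) -
    2 floor(M/d), which is never negative and at least 1 for M < d <= 2M. *)
Lemma psi_double M : psi M.*2 - psi M <= M%:R * (2 * ln 2).
Proof.
apply: le_trans (ln_fact_double M).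
have MM : (M <= M.*2)%N by rewrite -addnn leq_addr.
have widen (F : nat -> R) : (forall d, (M < d)%N -> F d = 0) ->
    \sum_(1 <= d < M.+1) F d = \sum_(1 <= d < M.*2.+1) F d.
  move=> F0; rewrite (@big_cat_nat _ _ _ M.+1 1 M.*2.+1) //=.
  by rewrite [X in _ + X]big_nat_cond [X in _ + X]big1 ?addr0 // => d /andP[/andP[/F0]].
rewrite !ln_fact_Mangoldt (widen (fun d => Lam d * (M %/ d)%:R)); last first.
  by move=> d Md; rewrite divn_small // mulr0.
have -> : psi M = \sum_(1 <= d < M.*2.+1) (if (d <= M)%N then Lam d else 0).
  rewrite -widen; last by move=> d; rewrite ltnNge => /negbTE ->.
  by apply: eq_big_nat => d /andP[_]; rewrite ltnS => ->.
rewrite mulr_sumr /psi -!sumrB big_nat_cond [leRHS]big_nat_cond.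
apply: ler_sum => d /andP[/andP[d0 dM] _].
have L0 := Mangoldt_ge0 R d.
have H1 : (2 * (M %/ d) <= M.*2 %/ d)%N.
  by rewrite leq_divRL //; have := leq_divM M d; lia.
have H2 : (M < d -> 1 <= M.*2 %/ d)%N by move=> _; rewrite leq_divRL //; lia.
case: leqP => Md.
  have : (2 * (M %/ d))%:R <= (M.*2 %/ d)%:R :> R by rewrite ler_nat.
  by rewrite natrM; nra.
rewrite [(M %/ d)%N]divn_small // mulr0 mulr0 subr0 subr0.
have : 1 <= (M.*2 %/ d)%:R :> R by rewrite ler1n H2.
by nra.
Qed.

Lemma psi_bound N : psi N <= 7 / 4 * N%:R.
Proof.
elim/ltn_ind: N => N IH; have /andP[_ l2] := ln2_bounds R.
case: N IH => [|N] IH; first by rewrite /psi big_geq // mulr0.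
have NE := odd_double_half N.+1; set M := N.+1./2 in NE.
have ME : (M < N.+1)%N by rewrite /M; lia.
have := IH M ME; have := psi_double M.
have m0 : 0 <= M%:R :> R by [].
rewrite -NE; case: (odd N.+1); rewrite /= ?add0n ?add1n; last first.
  by rewrite -mul2n natrM; nra.
rewrite psiS.
(* The tangent of ln at 8: its slope 1/8 consumes exactly the margin M/4 that psi (2M) <= (7/4 +
   3/2) M leaves below 7/2 M. *)
have H : Lam M.*2.+1 <= (2 * M%:R + 1) / 8 - 1 + 3 * ln 2.
  apply: le_trans (Mangoldt_le_ln R _) _.
  have -> : M.*2.+1%:R = 2 * M%:R + 1 :> R by rewrite -[_.+1]addn1 natrD -mul2n natrM.
  have := @ln_le_sub1 R ((2 * M%:R + 1) / 2 ^+ 3).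
  rewrite ln_div ?posrE ?exprn_gt0 //; last lra.
  by rewrite lnXn // -[_ *+ 3]mulr_natl => /(_ ltac:(lra)); lra.
have -> : M.*2.+1%:R = 2 * M%:R + 1 :> R by rewrite -[_.+1]addn1 natrD -mul2n natrM.
by nra.
Qed.

End Chebyshev.

(** * Mertens' bound and Moebius inversion *)

Section Selberg.
Variable R : realType.
Implicit Types (M N n d k : nat) (x y : R).

Local Notation Lam := (Mangoldt R).
Local Notation mu := (Moebius R).
Local Notation psi := (psi R).
Local Notation ln_fact := (ln_fact R).

Lemma ln_fact_bounds N : (0 < N)%N ->
  N%:R * ln N%:R - N%:R <= ln_fact N <= N%:R * ln N%:R - N%:R + ln N%:R + 1.
Proof.
case: N => // N _; elim: N => [|N /andP[IH1 IH2]].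
  by rewrite /ln_fact big_nat1 ln1 mulr0; apply/andP; split; lra.
rewrite /ln_fact big_nat_recr //= -/(ln_fact _).
have n0 : 0 < N.+1%:R :> R by rewrite ltr0n.
have /andP[] := @ln_succ_bounds R N.+1 isT.
rewrite -[N.+2%:R]natr1.
set m : R := N.+1%:R in n0 IH1 IH2 *.
set a := ln m in IH1 IH2 *; set b := ln (m + 1); set w := ln_fact N.+1 in IH1 IH2 *.
move=> H1 H2.
have H3 : 1 <= (m + 1) * (b - a) by rewrite mulrC -ler_pdivrMr ?mul1r //; lra.
have H4 : m * (b - a) <= 1 by rewrite mulrC -ler_pdivlMr ?mul1r.
by apply/andP; split; nra.
Qed.

Definition Mertens_sum N : R := \sum_(1 <= n < N.+1) Lam n / n%:R.

(** Replacing N/d by its integer part turns [N%:R * Mertens_sum N] into ln N! at a cost of at most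
    psi N. In the upper bound the term -N of Stirling's formula cancels ln N + 1 <= N, which leaves
    Chebyshev's constant 7/4. *)
Lemma Mertens_bounds N : (0 < N)%N ->
  ln N%:R - 1 <= Mertens_sum N <= ln N%:R + 7 / 4.
Proof.
move=> N0; have n0 : 0 < N%:R :> R by rewrite ltr0n.
have /andP[F1 F2] := ln_fact_bounds N0.
have L1 : ln (N%:R : R) <= N%:R - 1 by apply: ln_le_sub1.
have P := psi_bound R N.
have H1 : ln_fact N <= N%:R * Mertens_sum N.
  rewrite ln_fact_Mangoldt mulr_sumr ler_sum_nat // => d /andP[d0 _].
  rewrite mulrCA ler_wpM2l ?Mangoldt_ge0 // ler_pdivlMr ?ltr0n //.
  by rewrite -natrM ler_nat leq_divM.
have H2 : N%:R * Mertens_sum N <= ln_fact N + psi N.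
  rewrite ln_fact_Mangoldt mulr_sumr -big_split ler_sum_nat // => d /andP[d0 _] /=.
  rewrite mulrCA -{3}[Lam d]mulr1 -mulrDr ler_wpM2l ?Mangoldt_ge0 //.
  rewrite ler_pdivrMr ?ltr0n // natr1 -natrM ler_nat.
  by have := ltn_ceil N d0; lia.
by apply/andP; split; nra.
Qed.

Definition harmonic_sum N : R := \sum_(1 <= n < N.+1) n%:R^-1.

(** The constant lies between the increasing [v] and the decreasing [u]; it is taken as the supremum
    of [v], and v <= g <= u <= v + 1/N gives the rate. *)
Lemma Euler_gamma : exists2 g : R, 0 <= g <= 1 &
  forall N, (0 < N)%N -> 0 <= harmonic_sum N - ln N%:R - g <= N%:R^-1.
Proof.
pose u N : R := harmonic_sum N - ln N%:R.
pose v N : R := harmonic_sum N - ln N.+1%:R.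
have u_decr N : (0 < N)%N -> u N.+1 <= u N.
  move=> N0; rewrite /u /harmonic_sum big_nat_recr //=.
  have /andP[+ _] := ln_succ_bounds R N0.
  by set i := _^-1; set a := ln N.+1%:R; set b := ln N%:R => H; lra.
have v_incr N : v N <= v N.+1.
  rewrite /v /harmonic_sum [in leRHS]big_nat_recr //=.
  have /andP[_] := @ln_succ_bounds R N.+1 isT.
  by set i := _^-1; set a := ln N.+2%:R; set b := ln N.+1%:R => H; lra.
have v_mono M N : (M <= N)%N -> v M <= v N.
  move=> MN; rewrite -(subnKC MN); elim: (N - M)%N => [|k IH]; first by rewrite addn0.
  by rewrite addnS (le_trans IH).
have u_mono M N : (0 < M <= N)%N -> u N <= u M.
  move=> /andP[M0 MN]; rewrite -(subnKC MN); elim: (N - M)%N => [|k IH]; first by rewrite addn0.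
  by rewrite addnS (le_trans _ IH) // u_decr // addn_gt0 M0.
have v_le_u N : (0 < N)%N -> v N <= u N <= v N + N%:R^-1.
  move=> N0; have /andP[H1 H2] := ln_succ_bounds R N0.
  have {}H1 := le_trans _ H1; have := H1 0; rewrite invr_ge0 ler0n => /(_ isT).
  move: H2; rewrite /u /v; set i := _^-1; set a := ln N.+1%:R; set b := ln N%:R.
  by move=> H2 H3; apply/andP; split; lra.
have vu M N : (0 < N)%N -> v M <= u N.
  move=> N0; have mx : (0 < maxn M N)%N by rewrite leq_max N0 orbT.
  have /andP[H _] := v_le_u _ mx.
  apply: le_trans (v_mono _ _ (leq_maxl M N)) (le_trans H (u_mono _ _ _)).
  by rewrite N0 leq_maxr.
pose E := [set x : R | exists n, x = v n]%classic.
have Eub : ubound E (u 1%N) by move=> _ [n ->]; apply: vu.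
have Esup : has_sup E by split; [exists (v 0%N), 0%N | exists (u 1%N)].
have vg n : v n <= sup E by apply: ub_le_sup; [exists (u 1%N)|exists n].
have gu N : (0 < N)%N -> sup E <= u N.
  by move=> N0; apply: ge_sup; [case: Esup|move=> _ [n ->]; apply: vu].
exists (sup E).
  apply/andP; split.
    by apply: le_trans (vg 0%N); rewrite /v /harmonic_sum big_geq // ln1 subr0.
  by apply: le_trans (gu 1%N isT) _; rewrite /u /harmonic_sum big_nat1 ln1 invr1 subr0.
move=> N N0; have /andP[H1 H2] := v_le_u N N0; have := vg N; have := gu N N0.
by rewrite -/(u N) => H3 H4; apply/andP; split; lra.
Qed.

(** Convolving [mu] with ln = Lambda * 1 gives Lambda. Expanding ln (k/d) = ln k - ln d leaves the
    stated sum, because ln k times the divisor sum of [mu] vanishes for k = 1 as well as for k >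
    1. *)
Lemma sum_Moebius_ln k : (0 < k)%N ->
  \sum_(1 <= d < k.+1 | (d %| k)%N) mu d * ln d%:R = - Lam k.
Proof.
move=> k0.
have E : \sum_(1 <= d < k.+1 | (d %| k)%N) mu d * ln (k %/ d)%:R = Lam k.
  transitivity (\sum_(1 <= d < k.+1 | (d %| k)%N)
     \sum_(1 <= e < (k %/ d).+1 | (e %| k %/ d)%N) mu d * Lam e).
    rewrite big_nat_cond [RHS]big_nat_cond; apply: eq_bigr => d /andP[/andP[d0 _] dk].
    by rewrite -mulr_sumr sum_Mangoldt_divisors // divn_gt0 // dvdn_leq.
  rewrite sum_divisors_sym //.
  transitivity (\sum_(1 <= e < k.+1 | e == k) Lam e); last exact: sum_dvd_single.
  rewrite big_mkcond [RHS]big_mkcond; apply: eq_big_nat => e /andP[e0 _].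
  case: ifP => ek; last first.
    by case: eqP ek => // ->; rewrite dvdnn.
  have ke0 : (0 < k %/ e)%N by rewrite divn_gt0 // dvdn_leq.
  rewrite -mulr_suml sum_Moebius_divisors //.
  have -> : (k %/ e == 1)%N = (e == k).
    by apply/eqP/eqP => [H|->]; [rewrite -(divnK ek) H mul1n|rewrite divnn k0].
  by case: eqP; rewrite ?mul1r ?mul0r.
have E2 : \sum_(1 <= d < k.+1 | (d %| k)%N) mu d * ln (k %/ d)%:R
        = ln k%:R * (k == 1%N)%:R - \sum_(1 <= d < k.+1 | (d %| k)%N) mu d * ln d%:R.
  rewrite -sum_Moebius_divisors // mulr_sumr -sumrB big_nat_cond [RHS]big_nat_cond.
  apply: eq_bigr => d /andP[/andP[d0 _] dk].
  have kd0 : (0 < k %/ d)%N by rewrite divn_gt0 // dvdn_leq.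
  have -> : ln (k%:R : R) = ln (k %/ d)%:R + ln d%:R.
    by rewrite -[in LHS](divnK dk) natrM lnM ?posrE ?ltr0n.
  by ring.
rewrite E in E2; rewrite E2.
by case: eqP => [->|_]; rewrite ?mulr1n ?ln1 ?mulr0n; ring.
Qed.

(** The Tatuzawa-Iseki identity. Grouping by k = d n, the coefficient of [f k] is the divisor sum of
    mu d (ln N - ln d), that is Lambda k, plus ln N if k = 1. *)
Lemma sum_Moebius_log_ratio N (f : nat -> R) : (0 < N)%N ->
  \sum_(1 <= d < N.+1) mu d * ln (N%:R / d%:R) * \sum_(1 <= n < (N %/ d).+1) f (d * n)%N
  = f 1%N * ln N%:R + \sum_(1 <= k < N.+1) f k * Lam k.
Proof.
move=> N0.
transitivity (\sum_(1 <= d < N.+1) \sum_(1 <= n < (N %/ d).+1)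
    mu d * ln (N%:R / d%:R) * f (d * n)%N).
  by apply: eq_bigr => d _; rewrite mulr_sumr.
rewrite -sum_dirichlet.
have -> : f 1%N * ln N%:R = \sum_(1 <= k < N.+1 | k == 1%N) f k * ln N%:R.
  by rewrite (sum_dvd_single (fun k => f k * ln N%:R)).
rewrite [X in X + _]big_mkcond -big_split; apply: eq_big_nat => k /andP[k0 _] /=.
transitivity (\sum_(1 <= d < k.+1 | (d %| k)%N)
   (f k * ln N%:R * mu d - f k * (mu d * ln d%:R))).
  rewrite big_nat_cond [RHS]big_nat_cond; apply: eq_bigr => d /andP[/andP[d0 _] dk].
  by rewrite mulnC divnK // ln_div ?posrE ?ltr0n //; ring.
rewrite sumrB -!mulr_sumr sum_Moebius_divisors // sum_Moebius_ln //.
by case: ifP => _; rewrite ?mulr1n ?mulr0n; ring.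
Qed.

End Selberg.

(** * Selberg's formula *)

Section SelbergFormula.
Variable R : realType.
Implicit Types (M N n d k : nat) (x y : R).

Local Notation Lam := (Mangoldt R).
Local Notation mu := (Moebius R).
Local Notation psi := (psi R).
Local Notation ln_fact := (ln_fact R).

Lemma sum_inv_sqrt N :
  \sum_(1 <= d < N.+1) (Num.sqrt d%:R)^-1 <= 2 * Num.sqrt (N%:R : R).
Proof.
elim: N => [|N IH]; first by rewrite big_geq // mulr_ge0 // sqrtr_ge0.
rewrite big_nat_recr //= (le_trans (lerD IH (lexx _))) //.
have A : Num.sqrt (N.+1%:R : R) ^+ 2 = Num.sqrt N%:R ^+ 2 + 1.
  by rewrite !sqr_sqrtr ?natr1.
have a0 : 0 < Num.sqrt (N.+1%:R : R) by rewrite sqrtr_gt0 ltr0n.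
move: A a0; set a := Num.sqrt _; set b := Num.sqrt _ => A a0.
have : a^-1 <= 2 * (a - b).
  by rewrite -[leLHS]mul1r ler_pdivrMr //; nra.
lra.
Qed.

Lemma ln_le_sqrt_sqrt y : 1 <= y -> ln y <= 4 * (Num.sqrt (Num.sqrt y) - 1).
Proof.
move=> y1; have y0 : 0 < y by lra.
set t := Num.sqrt (Num.sqrt y).
have t0 : 0 < t by rewrite !sqrtr_gt0.
have -> : y = t ^+ 4.
  by rewrite (exprM _ 2 2) sqr_sqrtr ?sqrtr_ge0 // sqr_sqrtr // ltW.
rewrite lnXn // -[_ *+ 4]mulr_natl ler_pM2l ?ln_le_sub1 //.
Qed.

(** With t the fourth root of y = N/d, ln y <= 4 (t - 1) gives ln y (ln y + 3) <= 4 (t - 1)(4 t - 1)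
    <= 16 sqrt y, and summing d^(-1/2) turns this into 32 N. *)
Lemma sum_ln_ratio_sq N :
  \sum_(1 <= d < N.+1) ln (N%:R / d%:R) * (ln (N%:R / d%:R) + 3) <= 32 * N%:R :> R.
Proof.
have H : \sum_(1 <= d < N.+1) 16 * Num.sqrt N%:R * (Num.sqrt d%:R)^-1 <= 32 * N%:R :> R.
  rewrite -mulr_sumr; apply: le_trans (ler_wpM2l _ (sum_inv_sqrt N)) _.
    by rewrite mulr_ge0 // sqrtr_ge0.
  by have := sqr_sqrtr (ler0n R N); nra.
apply: le_trans H; apply: ler_sum_nat => d /andP[d0 dN].
have n0 : 0 < d%:R :> R by rewrite ltr0n.
have y1 : 1 <= N%:R / d%:R :> R by rewrite ler_pdivlMr // mul1r ler_nat.
rewrite -mulrA -sqrtrV // -sqrtrM //.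
set y : R := N%:R / d%:R in y1 *.
have := ln_le_sqrt_sqrt y1; have := ln_ge0 y1.
have : Num.sqrt (Num.sqrt y) ^+ 2 = Num.sqrt y by rewrite sqr_sqrtr // sqrtr_ge0.
have := sqrtr_ge0 (Num.sqrt y).
set t := Num.sqrt (Num.sqrt y) => t0 <- l0 l1.
have : 0 <= 4 * t - ln y by lra.
nra.
Qed.

Definition psi_conv N : R := \sum_(1 <= k < N.+1) Lam k * psi (N %/ k).

(* The constant [g + 1] makes the main terms of the three sums cancel, so that only a
   logarithm survives; its square is summable over [d] by [sum_ln_ratio_sq]. *)
Lemma Selberg_remainder (g : R) N d :
  0 <= g <= 1 ->
  (forall M, (0 < M)%N -> 0 <= harmonic_sum R M - ln M%:R - g <= M%:R^-1) ->
  (0 < d <= N)%N ->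
  `|\sum_(1 <= n < (N %/ d).+1) (psi (N %/ (d * n)) - N%:R / (d * n)%:R + (g + 1))|
    <= ln (N%:R / d%:R) + 3.
Proof.
move=> /andP[g0 g1] Hg /andP[d0 dN].
set M := (N %/ d)%N.
have M0 : (0 < M)%N by rewrite divn_gt0.
set y : R := N%:R / d%:R.
have n0 : 0 < d%:R :> R by rewrite ltr0n.
have m1 : 1 <= M%:R :> R by rewrite ler1n.
have My : M%:R <= y by rewrite ler_pdivlMr // -natrM ler_nat leq_divM.
have yM : y <= M%:R + 1.
  by rewrite ler_pdivrMr // natr1 -natrM ler_nat ltnW // ltn_ceil.
have -> : \sum_(1 <= n < M.+1) (psi (N %/ (d * n)) - N%:R / (d * n)%:R + (g + 1))
   = ln_fact M - y * harmonic_sum R M + M%:R * (g + 1).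
  rewrite big_split sumrB /= big_const_nat subn1 iter_addr_0 mulr_natl; congr (_ - _ + _).
    by rewrite ln_fact_psi; apply: eq_bigr => n _; rewrite divnMA.
  rewrite /harmonic_sum mulr_sumr; apply: eq_bigr => n _.
  by rewrite natrM invfM mulrA.
have /andP[F1 F2] := ln_fact_bounds R M0.
have /andP[] := Hg M M0.
have l0 : 0 <= ln (M%:R : R) by apply: ln_ge0.
have ll : ln M%:R <= ln y by rewrite ler_ln ?posrE //; lra.
set s := harmonic_sum R M - ln M%:R - g => s0 s1.
have -> : harmonic_sum R M = ln M%:R + g + s by rewrite /s; ring.
have ms : M%:R * s <= 1.
  by apply: le_trans (ler_wpM2l _ s1) _; rewrite ?divff //; lra.
have sle : s <= 1 by nra.
have q1 : (y - M%:R) * ln M%:R <= ln M%:R by nra.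
have q2 : 0 <= (y - M%:R) * ln M%:R by nra.
have q3 : (y - M%:R) * g <= 1 by nra.
have q4 : 0 <= (y - M%:R) * g by nra.
have q5 : y * s <= 2 by nra.
have q6 : 0 <= y * s by nra.
by rewrite ler_norml; apply/andP; split; nra.
Qed.

(** The Tatuzawa-Iseki identity is applied to psi (N/k) - N/k + g + 1. In the worst case 32 N from
    the Moebius sum, N from Mertens' bound and 11/2 N from the constant g + 1 add up, which stays
    below 40 N. *)
Theorem Selberg_formula N : (0 < N)%N ->
  `|psi N * ln N%:R + psi_conv N - 2 * N%:R * ln N%:R| <= 40 * N%:R.
Proof.
move=> N0; have [g g01 Hg] := Euler_gamma R.
have n0 : 0 < N%:R :> R by rewrite ltr0n.
pose f k : R := psi (N %/ k) - N%:R / k%:R + (g + 1).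
have S1 := sum_Moebius_log_ratio f N0.
have S2 : `|\sum_(1 <= d < N.+1) mu d * ln (N%:R / d%:R)
            * \sum_(1 <= n < (N %/ d).+1) f (d * n)%N| <= 32 * N%:R.
  apply: le_trans (ler_norm_sum _ _ _) (le_trans _ (sum_ln_ratio_sq N)).
  apply: ler_sum_nat => d dN.
  have /andP[d0 dN'] := dN; rewrite ltnS in dN'.
  have y1 : 1 <= N%:R / d%:R :> R by rewrite ler_pdivlMr ?ltr0n // mul1r ler_nat.
  rewrite !normrM [`|ln _|]ger0_norm ?ln_ge0 //.
  apply: ler_pM => //; rewrite ?mulr_ge0 ?ln_ge0 //.
    by rewrite -[leRHS]mul1r ler_wpM2r ?ln_ge0 ?Moebius_norm.
  exact: Selberg_remainder.
have S3 : f 1%N * ln N%:R + \sum_(1 <= k < N.+1) f k * Lam k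
  = psi N * ln N%:R + psi_conv N - N%:R * ln N%:R - N%:R * Mertens_sum R N
    + (g + 1) * (ln N%:R + psi N).
  have -> : \sum_(1 <= k < N.+1) f k * Lam k
      = psi_conv N - N%:R * Mertens_sum R N + (g + 1) * psi N.
    rewrite /psi_conv /Mertens_sum [in X in _ + X]/psi !mulr_sumr -sumrB -big_split.
    by apply: eq_bigr => k _; rewrite /f /=; ring.
  by rewrite /f divn1 divr1; ring.
rewrite S1 S3 in S2.
have /andP[M1 M2] := Mertens_bounds R N0.
have L1 : ln (N%:R : R) <= N%:R - 1 by apply: ln_le_sub1.
have L0 : 0 <= ln (N%:R : R) by apply: ln_ge0; rewrite ler1n.
have P := psi_bound R N; have P0 := psi_ge0 R N.
case/andP: g01 => g0 g1.
have q1 : (g + 1) * (ln N%:R + psi N) <= 2 * (N%:R + 7 / 4 * N%:R) by apply: ler_pM; lra.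
have q2 : 0 <= (g + 1) * (ln N%:R + psi N) by apply: mulr_ge0; lra.
move: S2; rewrite !ler_norml => /andP[S2 S2'].
by apply/andP; split; nra.
Qed.

End SelbergFormula.

(** * Intervals with few primes *)

Section ShortIntervals.
Variable R : realType.
Implicit Types (M N n d k a b : nat) (x y r : R).

Local Notation Lam := (Mangoldt R).
Local Notation psi := (psi R).
Local Notation psi_conv := (psi_conv R).

Lemma sum_widen_le M N (F : nat -> R) : (forall n, 0 <= F n) -> (M <= N)%N ->
  \sum_(1 <= n < M.+1) F n <= \sum_(1 <= n < N.+1) F n.
Proof.
move=> F0 MN; rewrite [leRHS](@big_cat_nat _ _ _ M.+1) //= lerDl.
by apply: sumr_ge0.
Qed.

Lemma psi_conv_le a b : (a <= b)%N -> psi_conv a <= psi_conv b.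
Proof.
move=> ab; apply: le_trans (_ : _ <= \sum_(1 <= k < a.+1) Lam k * psi (b %/ k)) _.
  by apply: ler_sum => k _; rewrite ler_wpM2l ?Mangoldt_ge0 // psi_le // leq_div2r.
apply: sum_widen_le => // k.
by rewrite mulr_ge0 ?Mangoldt_ge0 ?psi_ge0.
Qed.

Lemma ln_ratio_bounds a b r : (0 < a <= b)%N -> b%:R <= r * a%:R ->
  ln (a%:R : R) <= ln b%:R <= ln a%:R + r.
Proof.
move=> /andP[a0 ab] bra.
have a0R : 0 < a%:R :> R by rewrite ltr0n.
have b0R : 0 < b%:R :> R by rewrite ltr0n (leq_trans a0).
apply/andP; split; first by rewrite ler_ln ?posrE ?ler_nat.
have := @ln_le_sub1 R (b%:R / a%:R) (divr_gt0 b0R a0R).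
rewrite ln_div ?posrE // => H.
have : b%:R / a%:R <= r by rewrite ler_pdivrMr.
lra.
Qed.

(* The sum over pairs in Selberg's formula is monotone, so dropping it leaves an
   upper bound with twice the expected density. *)
Lemma psi_short_interval r : 1 <= r -> exists2 K, 1 <= K &
  forall a b, (0 < a <= b)%N -> b%:R <= r * a%:R ->
  (psi b - psi a) * ln a%:R <= 2 * (b%:R - a%:R) * ln a%:R + K * a%:R.
Proof.
move=> r1; exists (2 * r * r + 40 * r + 40); first by nra.
move=> a b /[dup] ab' /andP[a0 ab] bra.
have b0 : (0 < b)%N by apply: leq_trans ab.
have a0R : 0 < a%:R :> R by rewrite ltr0n.
have abR : a%:R <= b%:R :> R by rewrite ler_nat.
have /andP[l1 l2] := ln_ratio_bounds ab' bra.
have := Selberg_formula R a0; have := Selberg_formula R b0.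
rewrite !ler_norml => /andP[_ Hb] /andP[Ha _].
have Hc := psi_conv_le ab; have P := psi_ge0 R b.
set la := ln a%:R in l1 l2 Ha *; set lb := ln b%:R in l1 l2 Hb *.
have q1 : psi b * la <= psi b * lb by apply: ler_wpM2l.
have q2 : b%:R * (lb - la) <= r * a%:R * r by apply: ler_pM; lra.
nra.
Qed.

End ShortIntervals.

(** * The total deficit over m when psi hardly grows on (N, N'] *)

Section Averaging.
Variable R : realType.
Implicit Types (M N n d k a b X : nat) (x y r : R).

Local Notation Lam := (Mangoldt R).
Local Notation psi := (psi R).
Local Notation psi_conv := (psi_conv R).

(** The shortfall from Selberg's maximal value. The slack with [eta] absorbs the error term of the
    short interval bound and the rounding of N/m, so that the shortfall is nonnegative for m <= N/X
    and its weighted sum can be localized. *)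
Definition deficit (eta : R) N N' m : R :=
  (2 * (N'%:R - N%:R) + eta * N%:R) / m%:R - (psi (N' %/ m) - psi (N %/ m)).

Lemma deficit_ge0 r K eta N N' X m :
  1 <= r ->
  (forall a b, (0 < a <= b)%N -> b%:R <= 2 * r * a%:R ->
    (psi b - psi a) * ln a%:R <= 2 * (b%:R - a%:R) * ln a%:R + K * a%:R) ->
  1 <= K -> 0 <= eta -> K + 2 <= eta * ln X%:R -> (1 < X)%N ->
  (N <= N')%N -> N'%:R <= r * N%:R -> (0 < m <= N %/ X)%N ->
  0 <= deficit eta N N' m.
Proof.
move=> r1 short K1 eta0 KX X1 NN NrN /andP[m0 mX].
set A := (N %/ m)%N; set B := (N' %/ m)%N.
have XA : (X <= A)%N by move: mX; rewrite !leq_divRL // ?(ltnW X1) // mulnC.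
have AB : (A <= B)%N by apply: leq_div2r.
have A0 : (0 < A)%N by apply: leq_trans XA; apply: ltnW.
have m0R : 0 < m%:R :> R by rewrite ltr0n.
have A1R : 1 <= A%:R :> R by rewrite ler1n.
have ABR : A%:R <= B%:R :> R by rewrite ler_nat.
set y : R := N%:R / m%:R; set y' : R := N'%:R / m%:R.
have Ay : A%:R <= y by rewrite ler_pdivlMr // -natrM ler_nat leq_divM.
have yA : y <= A%:R + 1 by rewrite ler_pdivrMr // natr1 -natrM ler_nat ltnW // ltn_ceil.
have By : B%:R <= y' by rewrite ler_pdivlMr // -natrM ler_nat leq_divM.
have yry : y' <= r * y by rewrite /y /y' mulrA ler_pM2r ?invr_gt0.
(* B <= r (A + 1) <= 2 r A: because of the rounding of N/m the short interval bound is required up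
   to the ratio 2 r. *)
have BA : B%:R <= 2 * r * A%:R by nra.
have AB' : (0 < A <= B)%N by rewrite A0.
have := short A B AB' BA.
have X0R : 0 < X%:R :> R by rewrite ltr0n ltnW.
have lX0 : 0 < ln (X%:R : R) by apply: ln_gt0; rewrite ltr1n.
have lXA : ln X%:R <= ln (A%:R : R) by rewrite ler_ln ?posrE ?ler_nat // ltr0n.
have lA : ln (A%:R : R) <= A%:R - 1 by apply: ln_le_sub1; lra.
(* [K] pays for the error term and 2 for replacing N/m by its integer part, since 2 ln A <= 2 A. *)
have KA : K + 2 <= eta * ln A%:R by nra.
have -> : deficit eta N N' m = 2 * (y' - y) + eta * y - (psi B - psi A).
  by rewrite /deficit /y /y' -/A -/B; field; lra.
set la := ln A%:R in lXA lA KA *; set D := psi B - psi A => H.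
have la0 : 0 < la by lra.
rewrite subr_ge0 -(ler_pM2r la0); apply: le_trans H _.
nra.
Qed.

(** For m > Y the increment is at most psi (N'/m) <= 7/4 N'/m, so this range costs only the Mertens
    sum over (Y, N'], which is ln X up to a constant when Y is N/X. *)
Lemma psi_conv_increment_le N N' Y : (Y <= N <= N')%N -> (0 < Y)%N ->
  psi_conv N' - psi_conv N <=
  \sum_(1 <= m < Y.+1) Lam m * (psi (N' %/ m) - psi (N %/ m))
  + 7 / 4 * N'%:R * (Mertens_sum R N' - Mertens_sum R Y).
Proof.
move=> /andP[YN NN] Y0.
have -> : psi_conv N = \sum_(1 <= m < N'.+1) Lam m * psi (N %/ m).
  rewrite /psi_conv [RHS](@big_cat_nat _ _ _ N.+1) //= [X in _ = _ + X]big_nat_cond.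
  rewrite [X in _ = _ + X]big1 ?addr0 // => m /andP[/andP[mN _] _].
  by rewrite divn_small // /psi big_geq // mulr0.
rewrite /psi_conv -sumrB (@big_cat_nat _ _ _ Y.+1) //=; last first.
  by rewrite ltnS (leq_trans YN).
apply: lerD.
  by apply: ler_sum => m _; rewrite mulrBr.
rewrite /Mertens_sum [X in X - _](@big_cat_nat _ _ _ Y.+1) //=; last first.
  by rewrite ltnS (leq_trans YN).
rewrite [_ + _ - _]addrAC subrr add0r mulr_sumr; apply: ler_sum_nat => m /andP[Ym _].
have m0 : (0 < m)%N by apply: leq_trans Ym.
have m0R : 0 < m%:R :> R by rewrite ltr0n.
rewrite -mulrBr mulrCA ler_wpM2l ?Mangoldt_ge0 //.
apply: le_trans (_ : _ <= psi (N' %/ m)) _; first by rewrite gerBl psi_ge0.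
apply: le_trans (psi_bound R _) _; rewrite -[leRHS]mulrA.
apply: ler_wpM2l; first lra.
by rewrite ler_pdivlMr // -natrM ler_nat leq_divM.
Qed.

(** The arithmetic of [sum_deficit_le]: [n], [l], [p], [c] stand for N, ln N, psi N, psi_conv N,
    accented letters for the values at N', [MY] and [MN] for the Mertens sums at N/X and N', and [S]
    for the weighted sum of the increments. *)
Lemma sum_deficit_arith (r n n' l l' lX lY MY MN p p' c c' S delta eta : R) :
  1 <= r -> 0 < n -> n <= n' -> n' <= r * n ->
  0 <= delta -> delta <= 1 -> 0 <= eta -> eta <= 1 -> 0 <= p -> p <= 7 / 4 * n ->
  0 <= l -> 0 <= lX -> l <= l' -> l' <= l + r -> l <= 1 + lX + lY -> lY <= l ->
  p' - p <= delta * n ->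
  lY - 1 <= MY -> MY <= lY + 7 / 4 -> MN <= l' + 7 / 4 ->
  - (40 * n') <= p' * l' + c' - 2 * n' * l' ->
  p * l + c - 2 * n * l <= 40 * n ->
  c' - c <= S + 7 / 4 * n' * (MN - MY) ->
  (2 * (n' - n) + eta * n) * MY - S
  <= ((delta + eta) * l + (100 * r * r + 100) * (1 + lX)) * n.
Proof.
move=> r1 n0 nn nrn d0 d1 e0 e1.
have q5 : delta * n * r <= n * r.
  by rewrite -{2}[n]mul1r ler_wpM2r ?ler_wpM2r //; lra.
have q6 : eta * n <= n by rewrite -{2}[n]mul1r ler_wpM2r //; lra.
have q8 : n <= n * r by rewrite -{1}[n]mulr1 ler_wpM2l //; lra.
have q9 : n * r <= n * r * r by rewrite -{1}[n * r]mulr1 ler_wpM2l //; lra.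
have en0 : 0 <= 2 * (n' - n) + eta * n.
  by rewrite addr_ge0 ?mulr_ge0 ?subr_ge0 // ltW.
have dn0 : 0 <= delta * n by rewrite mulr_ge0 // ltW.
move=> p0 pb l0 lX0 ll ll2.
have l'0 : 0 <= l' by apply: le_trans ll.
have q10 : n * lX <= n * r * lX by apply: ler_wpM2r.
have q11 : 0 <= n * lX by rewrite mulr_ge0 // ltW.
have q7 : n * r * lX <= n * r * r * lX by apply: ler_wpM2r.
have q4 : n' * l <= n' * l' by apply: ler_wpM2l => //; apply: le_trans nn; apply: ltW.
have q12 : p * (l' - l) <= 7 / 4 * n * r.
  by apply: ler_pM; rewrite ?subr_ge0 // lerBlDl.
have q13 : delta * n * l' <= delta * n * (l + r) by apply: ler_wpM2l.
move=> h1 h2 gap MY1 MY2 hMN.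
have q14 : (p' - p) * l' <= delta * n * l' by apply: ler_wpM2r.
have q2 : (2 * (n' - n) + eta * n) * MY <= (2 * (n' - n) + eta * n) * (l + 7 / 4).
  by apply: ler_wpM2l => //; clear -MY2 h2; lra.
have q3 : n' * (MN - MY) <= r * n * (r + 4 + lX).
  apply: le_trans (_ : _ <= n' * (r + 4 + lX)) _.
    by apply: ler_wpM2l; [apply: le_trans nn; apply: ltW|clear -hMN MY1 h1 ll2; lra].
  by apply: ler_wpM2r => //; clear -r1 lX0; lra.
clear -q2 q3 q4 q5 q6 q7 q8 q9 q10 q11 q12 q13 q14 nn nrn n0.
lra.
Qed.

(** Selberg's formula at N is subtracted from that at N'. As psi hardly grows, nearly all of 2 (N' -
    N) ln N falls on [psi_conv], whereas the maximal values of the increments add up to 2 (N' - N)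
    times a Mertens sum, with the same main term. Cutting at N/X costs the term with ln X. *)
Lemma sum_deficit_le r : 1 <= r -> exists2 K, 1 <= K &
  forall N N' X (delta eta : R), (1 < X <= N)%N -> (N <= N')%N -> N'%:R <= r * N%:R ->
  0 <= delta <= 1 -> 0 <= eta <= 1 -> psi N' - psi N <= delta * N%:R ->
  \sum_(1 <= m < (N %/ X).+1) Lam m * deficit eta N N' m
  <= ((delta + eta) * ln N%:R + K * (1 + ln X%:R)) * N%:R.
Proof.
move=> r1; exists (100 * r * r + 100); first by nra.
move=> N N' X delta eta /andP[X1 XN] NN NrN /andP[d0 d1] /andP[e0 e1] gap.
have X0 : (0 < X)%N by apply: ltnW.
have N0 : (0 < N)%N by apply: leq_trans XN.
have N'0 : (0 < N')%N by apply: leq_trans NN.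
have N0R : 0 < N%:R :> R by rewrite ltr0n.
have X0R : 0 < X%:R :> R by rewrite ltr0n.
have NNR : N%:R <= N'%:R :> R by rewrite ler_nat.
set Y := (N %/ X)%N.
have Y0 : (0 < Y)%N by rewrite divn_gt0.
have Y0R : 0 < Y%:R :> R by rewrite ltr0n.
have YN : (Y <= N)%N by apply: leq_div.
have NXY : (N <= 2 * X * Y)%N.
  apply: leq_trans (ltnW (ltn_ceil N X0)) _.
  by rewrite -/Y mulnAC leq_mul2r; apply/orP; right; lia.
have lY : ln N%:R <= 1 + ln X%:R + ln (Y%:R : R).
  have /andP[_ l2] := ln2_bounds R.
  apply: le_trans (_ : _ <= ln (2 * X%:R * Y%:R)) _.
    by rewrite ler_ln ?posrE ?mulr_gt0 // -!natrM ler_nat.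
  rewrite lnM ?posrE ?mulr_gt0 // lnM ?posrE //; lra.
have NN' : (0 < N <= N')%N by rewrite N0.
have /andP[l1 l2] := ln_ratio_bounds NN' NrN.
have YNN : (Y <= N <= N')%N by rewrite YN.
have := Selberg_formula R N0; have := Selberg_formula R N'0.
rewrite !ler_norml => /andP[HN' _] /andP[_ HN].
have -> : \sum_(1 <= m < Y.+1) Lam m * deficit eta N N' m
    = (2 * (N'%:R - N%:R) + eta * N%:R) * Mertens_sum R Y
      - \sum_(1 <= m < Y.+1) Lam m * (psi (N' %/ m) - psi (N %/ m)).
  rewrite /Mertens_sum mulr_sumr -sumrB; apply: eq_bigr => m _.
  by rewrite /deficit; ring.
have /andP[_ MN'] := Mertens_bounds R N'0.
have /andP[MY1 MY2] := Mertens_bounds R Y0.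
have lYN : ln (Y%:R : R) <= ln N%:R by rewrite ler_ln ?posrE ?ler_nat.
apply: (@sum_deficit_arith r N%:R N'%:R (ln N%:R) (ln N'%:R) (ln X%:R) (ln Y%:R)
  (Mertens_sum R Y) (Mertens_sum R N') (psi N) (psi N') (psi_conv N) (psi_conv N')) => //.
- exact: psi_ge0.
- exact: psi_bound.
- by apply: ln_ge0; rewrite ler1n.
- by apply: ln_ge0; rewrite ler1n.
- exact: psi_conv_increment_le.
Qed.

End Averaging.

(** * Chains of near-extremal m and the contradiction with Chebyshev's bound *)

Section Chain.
Variable R : realType.
Implicit Types (M N n d k a b m X Z : nat) (x y r c kap eps eta : R).

Local Notation Lam := (Mangoldt R).
Local Notation psi := (psi R).

Lemma window_pigeonhole (F : nat -> R) M W I (s : R) :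
  (forall n, 0 <= F n) -> (0 < W)%N -> (0 < I)%N ->
  \sum_(1 <= n < (M * W ^ I).+1) F n <= s * I%:R ->
  exists2 i, (i < I)%N &
    \sum_((M * W ^ i).+1 <= n < (M * W ^ i * W).+1) F n <= s.
Proof.
move=> F0 W0 I0 HI.
pose P (i : 'I_I) := \sum_((M * W ^ i).+1 <= n < (M * W ^ i * W).+1) F n <= s.
have [/existsP[i Pi]|/existsPn Pn] := boolP [exists i, P i]; first by exists i.
(* The strict inequality is the aim, but it may fail for j = 0; the weak one starts the
   induction. *)
suff H j : (j <= I)%N -> s * j%:R <= \sum_(1 <= n < (M * W ^ j).+1) F n
           /\ ((0 < j)%N -> s * j%:R < \sum_(1 <= n < (M * W ^ j).+1) F n).
  by have [_ /(_ I0)] := H I (leqnn I); rewrite ltNge HI.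
elim: j => [_|j IH jI].
  by split => //; rewrite mulr0 sumr_ge0.
have [IH1 _] := IH (ltnW jI).
have := Pn (Ordinal jI); rewrite /P /= -ltNge => Pj.
suff H : s * j.+1%:R < \sum_(1 <= n < (M * W ^ j.+1).+1) F n.
  by split=> // ; apply: ltW.
rewrite (@big_cat_nat _ _ _ (M * W ^ j).+1) //=; last first.
  by rewrite ltnS leq_mul2l leq_pexp2l ?orbT.
by rewrite expnSr mulnA -natr1 mulrDr mulr1 ler_ltD.
Qed.

Definition near_extremal eps N N' m : Prop :=
  (2 * (N'%:R - N%:R) - eps * N%:R) / m%:R <= psi (N' %/ m) - psi (N %/ m).

(* Here [y], [y'] and [z'] stand for N/m, N/m' and N'/m', where [m < m'] are consecutive
   members of the chain, and [A], [B] for the integer parts of [y] and [z']. *)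
Lemma chain_step_arith (c kap eps eta y y' z' A B pA pA' pB : R) :
  0 < kap -> kap * (100 * (4 + c)) <= c -> 0 <= eps -> eps <= kap / 40 ->
  0 <= eta -> eta * (2 + 2 * c) <= kap / 40 -> 80 <= kap * y' ->
  y' * (1 + kap) <= y -> y <= y' * (1 + 101 / 100 * c) ->
  0 < c -> (1 + c) * y' <= z' -> y - 1 <= A -> A <= y -> B <= z' ->
  2 * (z' - y') - eps * y' <= pB - pA' ->
  (B <= A -> pB <= pA) ->
  (A < B -> pB - pA <= 2 * (B - A) + eta * A) ->
  19 / 10 * (y - y') <= pA - pA'.
Proof.
move=> k0 kc e0 ek eta0 etak ky yk yc c0 cz yA Ay Bz D H1 H2.
have y'0 : 0 < y' by rewrite -(pmulr_rgt0 _ k0); apply: lt_le_trans ky; lra.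
have kc4 : kap * 400 <= c by clear -kc c0 k0; nra.
have ey : eps * y' <= kap / 40 * y' by apply: ler_wpM2r => //; apply: ltW.
have kcy : kap * 400 * y' <= c * y' by apply: ler_wpM2r => //; apply: ltW.
case: (leP B A) => BA.
  have {}H1 := H1 BA.
  have : 0 < c * y' by apply: mulr_gt0.
  clear -D H1 ey cz kcy yc; lra.
have {}H2 := H2 BA.
have etaA : eta * A <= kap / 40 * y'.
  apply: le_trans (_ : _ <= eta * (2 + 2 * c) * y') _.
    rewrite -mulrA; apply: ler_wpM2l => //.
    have : 0 < c * y' by apply: mulr_gt0.
    clear -Ay yc y'0; nra.
  by apply: ler_wpM2r => //; apply: ltW.
clear -D H2 ey etaA Bz yA yk ky; nra.
Qed.

(** The interval (N/m', N'/m'] carries almost twice its length. Since m'/m is hardly larger than 1 +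
    c, it either ends before N/m while covering most of the way, or overshoots N/m by a piece whose
    mass is at most about twice its length. Both cases leave a density of at least 19/10 on (N/m',
    N/m]. *)
Lemma chain_step c kap eps eta r N N' M Z X m :
  0 < c -> 0 < kap -> kap * (100 * (4 + c)) <= c -> 0 <= eps -> eps <= kap / 40 ->
  0 <= eta -> eta * (2 + 2 * c) <= kap / 40 -> 1 <= r ->
  (1 + c) * N%:R <= N'%:R -> N'%:R <= r * N%:R ->
  (0 < X)%N -> 80 <= kap * X%:R -> (0 < M)%N -> 3 + c <= kap * M%:R -> (Z <= N %/ X)%N ->
  (forall a b, (X <= a <= b)%N -> b%:R <= 2 * r * a%:R ->
     psi b - psi a <= 2 * (b%:R - a%:R) + eta * a%:R) ->
  (forall a b, (M <= a)%N -> (1 + c + kap) * a%:R <= b%:R ->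
     b%:R <= (3 + c) * a%:R -> (b <= Z)%N ->
     exists2 m', (a < m' <= b)%N & near_extremal eps N N' m') ->
  (M <= m)%N -> (2 + 2 * c) * m%:R <= Z%:R ->
  exists m', [/\ near_extremal eps N N' m', (m < m' <= Z)%N,
    m'%:R <= (2 + 2 * c) * m%:R &
    19 / 10 * (N%:R / m%:R - N%:R / m'%:R) <= psi (N %/ m) - psi (N %/ m')].
Proof.
move=> c0 k0 kc e0 ek eta0 etak r1 cN NrN X0 kX M0 kM ZX short ex Mm mZ.
have m0 : (0 < m)%N by apply: leq_trans Mm.
have m0R : 0 < m%:R :> R by rewrite ltr0n.
have kc4 : kap * 400 <= c by clear -kc c0 k0; nra.
have k1 : kap <= 1 / 100 by clear -kc c0 k0; nra.
have km : 3 + c <= kap * m%:R.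
  by apply: le_trans kM _; rewrite ler_pM2l // ler_nat.
(* Taking m' above m (1 + kap) ensures that N/m - N/m' >= kap N/m' outweighs the errors from [eps],
   [eta] and rounding. On the other side (1 + kap)(1 + c + kap) and the two roundings stay below 1 +
   101/100 c, because kap (4 + c) <= c/100 and 3 + c <= kap m. *)
pose a := (Num.truncn (m%:R * (1 + kap))).+1.
have ma : m%:R * (1 + kap) < a%:R by apply: truncnS_gt.
have am : a%:R <= m%:R * (1 + kap) + 1.
  by rewrite -natr1 lerD2r truncn_le // mulr_ge0 //; lra.
pose b := (Num.truncn ((1 + c + kap) * a%:R)).+1.
have ab : (1 + c + kap) * a%:R < b%:R by apply: truncnS_gt.
have ba : b%:R <= (1 + c + kap) * a%:R + 1.
  by rewrite -natr1 lerD2r truncn_le // mulr_ge0 //; lra.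
have a1 : 1 <= a%:R :> R by rewrite ler1n.
have m1 : 1 <= m%:R :> R by rewrite ler1n.
have Ma : (M <= a)%N.
  apply: leq_trans Mm _; rewrite -(ler_nat R).
  apply: ltW; apply: le_lt_trans ma.
  by rewrite -{1}[m%:R]mulr1 ler_pM2l //; lra.
have bm : b%:R <= m%:R * (1 + 101 / 100 * c).
  clear -ba am km kc kc4 k0 k1 c0 m0R.
  have q1 : (1 + c + kap) * a%:R <= (1 + c + kap) * (m%:R * (1 + kap) + 1).
    by apply: ler_wpM2l => //; lra.
  have q2 : kap * (3 + c + kap) * m%:R <= c / 100 * m%:R.
    by apply: ler_wpM2r; [exact: ltW|nra].
  nra.
have bZ : (b <= Z)%N.
  rewrite -(ler_nat R); apply: le_trans bm (le_trans _ mZ).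
  by rewrite mulrC ler_pM2r //; lra.
have ba3 : b%:R <= (3 + c) * a%:R by clear -ba k1 a1; nra.
have [m' /andP[am' m'b] good] := ex a b Ma (ltW ab) ba3 bZ.
exists m'.
have mm' : (m < m')%N.
  apply: leq_trans am'; rewrite ltnS ltnW // -(ltr_nat R); apply: le_lt_trans ma.
  by rewrite -{1}[m%:R]mulr1 ler_pM2l //; lra.
have m'm : m'%:R <= m%:R * (1 + 101 / 100 * c).
  by apply: le_trans bm; rewrite ler_nat.
have mk : m%:R * (1 + kap) <= m'%:R.
  by apply: ltW; apply: lt_le_trans ma _; rewrite ler_nat ltnW.
have m'Z : (m' <= Z)%N by apply: leq_trans bZ.
split=> //.
- by rewrite mm'.
- by apply: le_trans m'm _; rewrite mulrC ler_pM2r //; lra.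
have m'0 : (0 < m')%N by apply: leq_trans mm'.
have m'0R : 0 < m'%:R :> R by rewrite ltr0n.
have N0R : 0 <= N%:R :> R by [].
set y := N%:R / m%:R; set y' := N%:R / m'%:R.
set A := (N %/ m)%N; set A' := (N %/ m')%N; set B := (N' %/ m')%N.
have XA' : (X <= A')%N.
  have := leq_trans m'Z ZX; rewrite leq_divRL // => H.
  by rewrite leq_divRL // mulnC.
have AA' : (A' <= A)%N by apply: leq_div2l => //; apply: ltnW.
have A'y : A'%:R <= y' by rewrite ler_pdivlMr // -natrM ler_nat leq_divM.
have Xy : X%:R <= y' by apply: le_trans A'y; rewrite ler_nat.
have yk : y' * (1 + kap) <= y.
  rewrite ler_pdivlMr // /y'.
  have -> : N%:R / m'%:R * (1 + kap) * m%:R = N%:R * (m%:R * (1 + kap) / m'%:R) by ring.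
  by rewrite ler_piMr // ler_pdivrMr // mul1r.
have yc : y <= y' * (1 + 101 / 100 * c).
  rewrite ler_pdivrMr // /y'.
  have -> : N%:R / m'%:R * (1 + 101 / 100 * c) * m%:R
          = N%:R * (m%:R * (1 + 101 / 100 * c) / m'%:R) by ring.
  by rewrite ler_peMr // ler_pdivlMr // mul1r.
have Ay : A%:R <= y by rewrite ler_pdivlMr // -natrM ler_nat leq_divM.
have yA : y <= A%:R + 1 by rewrite ler_pdivrMr // natr1 -natrM ler_nat ltnW // ltn_ceil.
pose z' : R := N'%:R / m'%:R.
have Bz : B%:R <= z' by rewrite ler_pdivlMr // -natrM ler_nat leq_divM.
have cz : (1 + c) * y' <= z' by rewrite /y' /z' mulrA ler_pM2r ?invr_gt0.
have zr : z' <= r * y' by rewrite /y' /z' mulrA ler_pM2r ?invr_gt0.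
have y'y : y' <= y by apply: ler_wpM2l => //; rewrite lef_pV2 ?posrE // ler_nat ltnW.
apply: (@chain_step_arith c kap eps eta y y' z' A%:R B%:R (psi A) (psi A') (psi B)) => //.
- by apply: le_trans kX _; rewrite ler_pM2l.
- by rewrite lerBlDr.
- apply: le_trans good; rewrite /y' /z'.
  have -> // : (2 * (N'%:R - N%:R) - eps * N%:R) / m'%:R
     = 2 * (N'%:R / m'%:R - N%:R / m'%:R) - eps * (N%:R / m'%:R) by ring.
- by rewrite ler_nat => /psi_le.
rewrite ltr_nat => AB; apply: short.
  by rewrite (leq_trans XA' AA') ltnW.
have A1 : 1 <= A%:R :> R by rewrite ler1n (leq_trans X0) // (leq_trans XA').
clear -A1 yA y'y zr Bz r1.
apply: le_trans Bz (le_trans zr _).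
rewrite [2 * r]mulrC -mulrA ler_wpM2l //; lra.
Qed.

(** A chain reaching 50 m0 forces psi (N/m0) >= 19/10 * 49/50 * N/m0. In the size of [Z] the factor
    3 + c allows for the choice of m0, 50 for the length of the chain and 2 + 2c for its last
    step. *)
Lemma chain_contradiction c kap eps eta r N N' M Z X :
  0 < c -> 0 < kap -> kap * (100 * (4 + c)) <= c -> 0 <= eps -> eps <= kap / 40 ->
  0 <= eta -> eta * (2 + 2 * c) <= kap / 40 -> 1 <= r -> (0 < N)%N ->
  (1 + c) * N%:R <= N'%:R -> N'%:R <= r * N%:R ->
  (0 < X)%N -> 80 <= kap * X%:R -> (0 < M)%N -> 3 + c <= kap * M%:R -> (Z <= N %/ X)%N ->
  50 * (3 + c) * (2 + 2 * c) * M%:R <= Z%:R ->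
  (forall a b, (X <= a <= b)%N -> b%:R <= 2 * r * a%:R ->
     psi b - psi a <= 2 * (b%:R - a%:R) + eta * a%:R) ->
  (forall a b, (M <= a)%N -> (1 + c + kap) * a%:R <= b%:R ->
     b%:R <= (3 + c) * a%:R -> (b <= Z)%N ->
     exists2 m', (a < m' <= b)%N & near_extremal eps N N' m') ->
  False.
Proof.
move=> c0 k0 kc e0 ek eta0 etak r1 N0 cN NrN X0 kX M0 kM ZX MZ short ex.
have k1 : kap <= 1 / 100 by clear -kc c0 k0; nra.
have M1 : 1 <= M%:R :> R by rewrite ler1n.
have N0R : 0 < N%:R :> R by rewrite ltr0n.
pose b := (Num.truncn ((1 + c + kap) * M%:R)).+1.
have Mb : (1 + c + kap) * M%:R < b%:R by apply: truncnS_gt.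
have bM : b%:R <= (1 + c + kap) * M%:R + 1.
  by rewrite -natr1 lerD2r truncn_le // mulr_ge0 //; lra.
have bM3 : b%:R <= (3 + c) * M%:R by clear -bM k1 M1; nra.
have bZ : (b <= Z)%N.
  rewrite -(ler_nat R); apply: le_trans bM3 (le_trans _ MZ).
  by rewrite ler_pM2r; [clear -c0; nra|lra].
have [m0 /andP[Mm0 m0b] good0] := ex M b (leqnn M) (ltW Mb) bM3 bZ.
have m00 : (0 < m0)%N by apply: leq_trans Mm0.
have m00R : 0 < m0%:R :> R by rewrite ltr0n.
have m0M3 : m0%:R <= (3 + c) * M%:R by apply: le_trans bM3; rewrite ler_nat.
(* Each step raises m by at least 1, so 50 m0 steps certainly suffice; once m has passed 50 m0 the
   chain stands still. *)
have chain k : exists m, [/\ near_extremal eps N N' m, (m0 <= m <= Z)%N,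
    (m0 + k <= m)%N \/ (50 * m0 <= m)%N &
    19 / 10 * (N%:R / m0%:R - N%:R / m%:R) <= psi (N %/ m0) - psi (N %/ m)].
  elim: k => [|k [m [good /andP[m0m mZ] alt dens]]].
    exists m0; split => //; rewrite ?leqnn ?(leq_trans m0b) //; first by left; rewrite addn0.
    by rewrite !subrr mulr0.
  have [m50|m50] := leqP (50 * m0) m.
    by exists m; split => //; [rewrite m0m|right].
  have mc : (2 + 2 * c) * m%:R <= Z%:R.
    have : m%:R <= 50 * m0%:R :> R by rewrite -natrM ler_nat ltnW.
    move=> m50R; apply: le_trans MZ.
    rewrite [_ * (2 + 2 * c)]mulrC -mulrA ler_pM2l; last lra.
    by apply: le_trans m50R _; rewrite -mulrA ler_pM2l.
  have Mm : (M <= m)%N by apply: leq_trans m0m; apply: ltnW.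
  have [m' [good' /andP[mm' m'Z] _ dens']] := chain_step c0 k0 kc e0 ek eta0 etak r1
    cN NrN X0 kX M0 kM ZX short ex Mm mc.
  exists m'; split=> //.
  - by rewrite m'Z (leq_trans m0m) // ltnW.
  - left; case: alt => [H|H]; last by move: m50; rewrite ltnNge H.
    by rewrite addnS (leq_ltn_trans H).
  - by clear -dens dens'; lra.
have [m [_ /andP[m0m mZ] alt dens]] := chain (50 * m0)%N.
have {}alt : (50 * m0 <= m)%N by case: alt => // /(leq_trans _); apply; apply: leq_addl.
have m0' : (0 < m)%N by apply: leq_trans m0m.
have yy : N%:R / m%:R <= N%:R / m0%:R / 50 :> R.
  have -> : N%:R / m0%:R / 50 = N%:R / (50 * m0)%:R :> R by rewrite natrM invfM mulrA mulrAC.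
  by apply: ler_wpM2l => //; rewrite lef_pV2 ?posrE ?ltr0n ?muln_gt0 // ler_nat.
have P := psi_bound R (N %/ m0).
have P0 := psi_ge0 R (N %/ m).
have : (N %/ m0)%:R <= N%:R / m0%:R :> R.
  by rewrite ler_pdivlMr // -natrM ler_nat leq_divM.
have : 0 < N%:R / m0%:R :> R by apply: divr_gt0.
clear -dens yy P P0; lra.
Qed.

End Chain.

(** * Decreasing the length of the intervals *)

Section Bootstrap.
Variable R : realType.
Implicit Types (M N n d k a b m W X Z I : nat) (x y r c kap eps eta B : R).

Local Notation Lam := (Mangoldt R).
Local Notation psi := (psi R).

(* [B] bounds both the logarithm of the threshold and the inverse of the density. *)
Definition psi_dense c B : Prop := forall a b,
  expR B <= a%:R -> (1 + c) * a%:R <= b%:R -> a%:R <= B * (psi b - psi a).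

Lemma psi_increment_le a b (g : nat -> R) y : (0 < a <= b)%N -> 0 <= y ->
  (forall m, (a < m <= b)%N -> y / m%:R <= g m) ->
  y / b%:R * (psi b - psi a) <= \sum_(a.+1 <= m < b.+1) Lam m * g m.
Proof.
move=> /andP[a0 ab] y0 Hg.
have -> : psi b - psi a = \sum_(a.+1 <= m < b.+1) Lam m.
  by rewrite /psi (@big_cat_nat _ _ _ a.+1) //= addrAC subrr add0r.
rewrite mulr_sumr; apply: ler_sum_nat => m amb.
rewrite mulrC ler_wpM2l ?Mangoldt_ge0 //; apply: le_trans (Hg m amb).
have /andP[am mb] := amb; have m0 : (0 < m)%N by apply: leq_trans am.
rewrite ler_wpM2l // lef_pV2 ?posrE ?ltr0n // ?ler_nat //.
exact: leq_trans ab.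
Qed.

(** Otherwise every m in (a, b] has a deficit of at least eps N/b, and by density these m have
    Lambda-mass at least a/B. This amounts to at least eps N / (B (3 + c)) > s, more than the whole
    window contains. *)
Lemma near_extremal_exists c kap eps eta B s N N' X M Z :
  0 < c -> 0 < kap -> 0 <= eps -> 0 <= eta -> 1 <= B ->
  (0 < N)%N -> (0 < M)%N -> (Z <= N %/ X)%N ->
  (forall m, (0 < m <= N %/ X)%N -> 0 <= deficit eta N N' m) ->
  psi_dense (c + kap) B -> expR B <= M%:R -> s * (B * (3 + c)) < eps * N%:R ->
  \sum_(M.+1 <= m < Z.+1) Lam m * deficit eta N N' m <= s ->
  forall a b, (M <= a)%N -> (1 + c + kap) * a%:R <= b%:R ->
     b%:R <= (3 + c) * a%:R -> (b <= Z)%N ->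
     exists2 m', (a < m' <= b)%N & near_extremal eps N N' m'.
Proof.
move=> c0 k0 e0 eta0 B1 N0 M0 ZX def0 dense BM sB window a b Ma ab ba bZ.
pose P m := (2 * (N'%:R - N%:R) - eps * N%:R) / m%:R <= psi (N' %/ m) - psi (N %/ m).
have [/hasP[m]|/hasPn none] := boolP (has P (index_iota a.+1 b.+1)).
  by rewrite mem_index_iota => amb Pm; exists m.
have a0 : (0 < a)%N by apply: leq_trans Ma.
have a0R : 0 < a%:R :> R by rewrite ltr0n.
have b0R : 0 < b%:R :> R by apply: lt_le_trans ab; rewrite mulr_gt0 //; lra.
have N0R : 0 < N%:R :> R by rewrite ltr0n.
have ab' : (a <= b)%N.
  rewrite -(ler_nat R); apply: le_trans ab; rewrite -{1}[a%:R]mul1r ler_pM2r //; lra.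
have H1 : eps * N%:R / b%:R * (psi b - psi a)
    <= \sum_(a.+1 <= m < b.+1) Lam m * deficit eta N N' m.
  apply: psi_increment_le; first by rewrite a0.
    by apply: mulr_ge0 => //; apply: ltW.
  move=> m amb; have := none m; rewrite mem_index_iota => /(_ amb).
  rewrite /P -ltNge /deficit => H.
  have m0 : 0 < m%:R :> R by rewrite ltr0n; case/andP: amb => /(leq_trans _) ->.
  apply: le_trans (_ : _ <= (eps + eta) * N%:R / m%:R) _.
    by rewrite ler_pM2r ?invr_gt0 // ler_pM2r //; lra.
  have -> : (2 * (N'%:R - N%:R) + eta * N%:R) / m%:R
    = (2 * (N'%:R - N%:R) - eps * N%:R) / m%:R + (eps + eta) * N%:R / m%:R by ring.
  by clear -H; lra.
have H2 : \sum_(a.+1 <= m < b.+1) Lam m * deficit eta N N' m <= s.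
  apply: le_trans window.
  have nonneg p q : (q <= Z)%N -> 0 <= \sum_(p.+1 <= m < q.+1) Lam m * deficit eta N N' m.
    move=> qZ; rewrite big_nat_cond; apply: sumr_ge0 => m /andP[/andP[pm mq] _].
    apply: mulr_ge0; first exact: Mangoldt_ge0.
    apply: def0; rewrite (leq_trans _ pm) //=.
    by rewrite (leq_trans _ ZX) // (leq_trans _ qZ).
  rewrite (@big_cat_nat _ _ _ a.+1 M.+1) ?ltnS //=; last exact: leq_trans bZ.
  rewrite (@big_cat_nat _ _ _ b.+1 a.+1 Z.+1) ?ltnS //=.
  rewrite addrCA lerDl addr_ge0 ?nonneg //.
  exact: leq_trans ab' bZ.
have H3 : a%:R <= B * (psi b - psi a).
  apply: dense; last by rewrite addrA.
  by apply: le_trans BM _; rewrite ler_nat.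
have : eps * N%:R * a%:R <= s * B * b%:R.
  have -> : eps * N%:R * a%:R = eps * N%:R / b%:R * a%:R * b%:R by field; lra.
  rewrite ler_pM2r //; apply: le_trans (_ : _ <= eps * N%:R / b%:R * (B * (psi b - psi a))) _.
    by apply: ler_wpM2l => //; rewrite !mulr_ge0 ?invr_ge0 // ltW.
  rewrite mulrCA [s * B]mulrC ler_wpM2l //; first lra.
  exact: le_trans H2.
have : s * B * b%:R <= s * B * ((3 + c) * a%:R).
  apply: ler_wpM2l => //; apply: mulr_ge0; last lra.
  apply: le_trans H2; apply: le_trans H1; rewrite !mulr_ge0 ?invr_ge0 ?(ltW N0R) ?(ltW b0R) //.
  by rewrite subr_ge0 psi_le.
have : s * (B * (3 + c)) * a%:R < eps * N%:R * a%:R by rewrite ltr_pM2r.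
clear; move=> h1 h2 h3; exfalso; lra.
Qed.

(** [X] cuts off the m for which N/m is too small for the short interval bound, and [M] lies beyond
    the threshold of density. The range (M, M W^I] is divided into [I] windows of ratio [W], each
    long enough for a complete chain; [s] bounds the average deficit of a window. *)
Lemma gap_contradiction c kap eps eta delta r K1 K2 B s N N' X M W I :
  0 < c -> 0 < kap -> kap * (100 * (4 + c)) <= c -> 0 <= eps -> eps <= kap / 40 ->
  0 <= eta <= 1 -> eta * (2 + 2 * c) <= kap / 40 -> 1 <= r -> 0 <= delta <= 1 ->
  1 <= K1 ->
  (forall a b, (0 < a <= b)%N -> b%:R <= 2 * r * a%:R ->
    (psi b - psi a) * ln a%:R <= 2 * (b%:R - a%:R) * ln a%:R + K1 * a%:R) ->
  (forall N N' X (delta eta : R), (1 < X <= N)%N -> (N <= N')%N -> N'%:R <= r * N%:R ->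
    0 <= delta <= 1 -> 0 <= eta <= 1 -> psi N' - psi N <= delta * N%:R ->
    \sum_(1 <= m < (N %/ X).+1) Lam m * deficit eta N N' m
    <= ((delta + eta) * ln N%:R + K2 * (1 + ln X%:R)) * N%:R) ->
  1 <= B -> psi_dense (c + kap) B -> expR B <= M%:R ->
  (1 + c) * N%:R <= N'%:R -> N'%:R <= r * N%:R ->
  psi N' - psi N <= delta * N%:R ->
  (1 < X)%N -> 80 <= kap * X%:R -> K1 + 2 <= eta * ln X%:R ->
  (0 < M)%N -> 3 + c <= kap * M%:R -> 50 * (3 + c) * (2 + 2 * c) <= W%:R -> (0 < W)%N ->
  (M * W ^ I <= N %/ X)%N -> (0 < I)%N ->
  ((delta + eta) * ln N%:R + K2 * (1 + ln X%:R)) * N%:R <= s * I%:R ->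
  s * (B * (3 + c)) < eps * N%:R ->
  False.
Proof.
move=> c0 k0 kc e0 ek eta01 etak r1 d01 K11 short avg B1 dense BM cN NrN gap X1 kX K1X.
move=> M0 kM cW W0 MI I0 total sB.
have [eta0 eta1] := andP eta01.
have X0 : (0 < X)%N by apply: ltnW.
have Y0 : (0 < N %/ X)%N by apply: leq_trans MI; rewrite muln_gt0 M0 expn_gt0 W0.
have XN : (X <= N)%N by move: Y0; rewrite divn_gt0.
have N0 : (0 < N)%N by apply: leq_trans XN.
have NN : (N <= N')%N.
  rewrite -(ler_nat R); apply: le_trans cN; rewrite -{1}[N%:R]mul1r ler_pM2r ?ltr0n //; lra.
have def0 m : (0 < m <= N %/ X)%N -> 0 <= deficit eta N N' m.
  exact: (deficit_ge0 r1 short).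
have X1N : (1 < X <= N)%N by rewrite X1.
have tot := le_trans (avg N N' X delta eta X1N NN NrN d01 eta01 gap) total.
(* The deficit is known to be nonnegative only for m <= N/X; the absolute value changes nothing
   there and makes the pigeonhole principle applicable. *)
pose F m := Lam m * `|deficit eta N N' m|.
have F0 m : 0 <= F m by rewrite mulr_ge0 ?Mangoldt_ge0.
have FE p q : (q <= N %/ X)%N -> \sum_(p.+1 <= m < q.+1) F m
    = \sum_(p.+1 <= m < q.+1) Lam m * deficit eta N N' m.
  move=> qX; apply: eq_big_nat => m /andP[pm mq]; rewrite /F ger0_norm // def0 //.
  by rewrite (leq_trans _ pm) //= (leq_trans _ qX).
have [|i iI] := @window_pigeonhole R F M W I s F0 W0 I0.
  by apply: le_trans tot; rewrite -FE // sum_widen_le.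
set M' := (M * W ^ i)%N; set Z := (M' * W)%N => window.
have MM' : (M <= M')%N by rewrite leq_pmulr // expn_gt0 W0.
have M'0 : (0 < M')%N by apply: leq_trans MM'.
have ZX : (Z <= N %/ X)%N.
  by apply: leq_trans MI; rewrite /Z /M' -mulnA -expnSr leq_mul2l leq_pexp2l ?orbT.
rewrite FE // in window.
have BM' : expR B <= M'%:R by apply: le_trans BM _; rewrite ler_nat.
have ex := near_extremal_exists c0 k0 e0 eta0 B1 N0 M'0 ZX def0 dense BM' sB window.
apply: (@chain_contradiction R c kap eps eta r N N' M' Z X) => //.
- by apply: le_trans kM _; rewrite ler_pM2l // ler_nat.
- by rewrite /Z natrM mulrC ler_pM2l // ltr0n.
move=> a b /andP[Xa ab] bra.
have a0 : (0 < a)%N by apply: leq_trans Xa.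
have := short a b; rewrite a0 ab => /(_ isT bra).
have lX : 0 < ln (X%:R : R) by apply: ln_gt0; rewrite ltr1n.
have la : ln X%:R <= ln (a%:R : R) by rewrite ler_ln ?posrE ?ltr0n ?ler_nat.
have la0 : 0 < ln (a%:R : R) by apply: lt_le_trans la.
have Kla : K1 * a%:R <= eta * ln a%:R * a%:R.
  apply: ler_wpM2r => //; apply: le_trans (ler_wpM2l eta0 la).
  by apply: le_trans K1X; rewrite lerDl.
move=> H; rewrite -(ler_pM2r la0); clear -H Kla; lra.
Qed.

End Bootstrap.

(** * Choice of the parameters in one reduction of c *)

Section Thresholds.
Variable R : realType.
Implicit Types (M N n d k a b m W X Z I : nat) (x y r c kap eps eta B : R).

Local Notation Lam := (Mangoldt R).
Local Notation psi := (psi R).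
Local Notation psi_dense := (@psi_dense R).

Lemma nat_near_expR x : 0 <= x -> exists n,
  [/\ (1 < n)%N, expR x <= n%:R, x <= ln (n%:R : R) & ln (n%:R : R) <= x + 1].
Proof.
move=> x0; pose n := (Num.truncn (expR x)).+1.
have e1 : 1 <= expR x by have := expR_ge1Dx x; lra.
have xn : expR x < n%:R by apply: truncnS_gt.
have nx : n%:R <= expR x + 1 by rewrite -natr1 lerD2r truncn_le expR_ge0.
have n0 : 0 < n%:R :> R by rewrite ltr0n.
exists n; split.
- by rewrite -(ltr_nat R); apply: le_lt_trans xn.
- exact: ltW.
- by rewrite -[leLHS]expRK ler_ln ?posrE ?expR_gt0 // ltW.
rewrite -[leRHS]expRK ler_ln ?posrE ?expR_gt0 //; apply: le_trans nx _.
rewrite expRD; have := expR_ge1Dx (1 : R); nra.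
Qed.

(** The origin of B^4: kap = theta c is at least theta/B, so the mass [sig] allowed per window,
    which is eps / (B (4 + c)), may be as small as order B^-2, and so may [tau]. The slack tau
    requires ln X of order 1/tau, that is B^2, and K2 ln X <= tau ln N then requires ln N of order
    B^4. *)
Lemma psi_dense_step_core c0 r K1 K2 W (theta tau0 Kx Km K : R) c B :
  1 <= c0 -> r = 3 + c0 -> 1 <= K1 -> 1 <= K2 ->
  (forall a b, (0 < a <= b)%N -> b%:R <= 2 * r * a%:R ->
    (psi b - psi a) * ln a%:R <= 2 * (b%:R - a%:R) * ln a%:R + K1 * a%:R) ->
  (forall N N' X (delta eta : R), (1 < X <= N)%N -> (N <= N')%N -> N'%:R <= r * N%:R ->
    0 <= delta <= 1 -> 0 <= eta <= 1 -> psi N' - psi N <= delta * N%:R ->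
    \sum_(1 <= m < (N %/ X).+1) Lam m * deficit eta N N' m
    <= ((delta + eta) * ln N%:R + K2 * (1 + ln X%:R)) * N%:R) ->
  0 < theta -> theta * (100 * (4 + c0)) = 1 ->
  (0 < W)%N -> 50 * (3 + c0) * (2 + 2 * c0) <= W%:R -> 1 / 2 <= ln (W%:R : R) ->
  0 < tau0 -> tau0 = theta / (480 * ln W%:R * (4 + c0)) ->
  K1 + 2 <= tau0 * Kx -> 80 <= theta * Kx -> 0 <= Kx -> 1 <= Km -> 3 + c0 <= theta * Km ->
  1 <= tau0 * K -> K2 * (2 + Kx) <= tau0 * K ->
  2 * (Km + Kx + ln W%:R + 2) <= K -> 1 <= K ->
  0 < c -> c <= c0 -> 1 <= B -> 1 <= c * B ->
  psi_dense (c * (1 + theta)) B -> psi_dense c (K * B ^+ 4).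
Proof.
move=> c01 rE K11 K21 short avg th0 thetaE W0 cW; set LW := ln W%:R => LW1 tau00 tau0E.
move=> Kx1 Kx2 Kx0 Km1 Km2 KA KB KC K1' cp cc B1 cB dense N b KN cNb.
have LW0 : 0 < LW by clear -LW1; lra.
have r1 : 1 <= r by rewrite rE; clear -c01; lra.
have B0 : 0 < B by lra.
have BB : B <= B ^+ 2 by rewrite expr2; clear -B1; nra.
have B4 : B ^+ 4 = B ^+ 2 * B ^+ 2 by rewrite -exprD.
have BB4 : B ^+ 2 <= B ^+ 4 by rewrite B4; clear -B1 BB; nra.
have B21 : 1 <= B ^+ 2 by clear -BB B1; lra.
have B41 : 1 <= B ^+ 4 by clear -BB4 B21; lra.
have KB41 : 1 <= K * B ^+ 4 by clear -K1' B41; nra.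
have N1 : 1 <= N%:R :> R.
  by apply: le_trans KN; have := expR_ge1Dx (K * B ^+ 4); clear -KB41; lra.
have N0 : (0 < N)%N by rewrite -(ltr0n R); clear -N1; lra.
have lN : K * B ^+ 4 <= ln (N%:R : R).
  by rewrite -[leLHS]expRK ler_ln ?posrE ?expR_gt0 ?ltr0n.
have [//|gap] := lerP N%:R (K * B ^+ 4 * (psi b - psi N)); exfalso.
(* A longer interval is cut down to ratio about 1 + c, which ensures N' <= r N; the upper bound for
   the increment of psi is inherited. *)
pose N' := minn b (Num.truncn ((1 + c) * N%:R)).+1.
have cN : (1 + c) * N%:R <= N'%:R.
  by rewrite /N' /minn; case: ifP => // _; apply: ltW; apply: truncnS_gt.
have NrN : N'%:R <= r * N%:R.
  apply: le_trans (_ : _ <= (Num.truncn ((1 + c) * N%:R)).+1%:R) _.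
    by rewrite ler_nat geq_minr.
  rewrite -natr1; apply: le_trans (_ : _ <= (1 + c) * N%:R + 1) _.
    by rewrite lerD2r truncn_le mulr_ge0 //; clear -cp; lra.
  by rewrite rE; clear -cc N1 cp; nra.
pose delta := (K * B ^+ 4)^-1.
have KB40 : 0 < K * B ^+ 4 by clear -KB41; lra.
have deltaE : delta * (K * B ^+ 4) = 1 by rewrite mulVf // gt_eqF.
have de0 : 0 < delta by rewrite invr_gt0.
have gap' : psi N' - psi N <= delta * N%:R.
  rewrite -ler_pdivrMl // invrK; apply: le_trans (ltW gap).
  rewrite ler_wpM2l ?(ltW KB40) //.
  by rewrite lerD2r psi_le // geq_minl.
pose kap := theta * c.
have k0 : 0 < kap by rewrite mulr_gt0.
have kc : kap * (100 * (4 + c)) <= c.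
  have -> : kap * (100 * (4 + c)) = theta * (100 * (4 + c)) * c by rewrite /kap; ring.
  rewrite -[leRHS]mul1r ler_pM2r // -[leRHS]thetaE ler_pM2l //.
  by clear -cc; lra.
have kB : theta <= kap * B by rewrite /kap -mulrA -{1}[theta]mulr1 ler_pM2l.
pose eps := kap / 40.
have e0 : 0 < eps by rewrite divr_gt0.
have B4c : 0 < B * (4 + c) by rewrite mulr_gt0 //; clear -cp; lra.
pose sig := eps / (B * (4 + c)).
have sig0 : 0 < sig by rewrite divr_gt0.
have sigE : sig * (B * (4 + c)) = eps by rewrite divfK // gt_eqF.
(* The three terms delta ln N, tau ln N and K2 (1 + ln X) will each be at most tau ln N, and ln N <=
   4 LW I; hence 12 = 3 * 4. *)
pose tau := sig / (12 * LW).
have LW12 : 0 < 12 * LW by rewrite mulr_gt0.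
have tau_gt0 : 0 < tau by rewrite divr_gt0.
have tauE : tau * (12 * LW) = sig by rewrite divfK // gt_eqF.
have tausig : 6 * tau <= sig by clear -tauE LW1 tau_gt0; nra.
have tau_small : tau * (2 + 2 * c) <= kap / 40.
  have H : sig * (4 + c) <= eps.
    rewrite -sigE mulrCA -{1}[_ * (4 + c)]mul1r; apply: ler_wpM2r => //.
    by rewrite mulr_ge0 ?(ltW sig0) //; clear -cp; lra.
  rewrite -/eps; apply: le_trans H; clear -tausig tau_gt0 cp; nra.
have tau_le1 : tau <= 1.
  have : kap <= 1 by clear -kc k0 cp; nra.
  by clear -tau_small tau_gt0 cp; nra.
have tauB : tau0 <= tau * B ^+ 2.
  have E : tau * (480 * LW * (4 + c)) * B = kap.
    have -> : tau * (480 * LW * (4 + c)) * B = 40 * (tau * (12 * LW) * (B * (4 + c))) by ring.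
    by rewrite tauE sigE /eps; clear; lra.
  have d0 : 0 < 480 * LW * (4 + c0) by rewrite !mulr_gt0 //; clear -c01; lra.
  rewrite tau0E ler_pdivrMr //; apply: le_trans kB _; rewrite -E.
  have -> : tau * (480 * LW * (4 + c)) * B * B = tau * B ^+ 2 * (480 * LW * (4 + c)) by ring.
  apply: ler_wpM2l; first by rewrite mulr_ge0 ?ltW // exprn_gt0.
  by apply: ler_wpM2l; [clear -LW0|clear -cc]; lra.
have [X [X1 eX lX1 lX2]] := @nat_near_expR (Kx * B ^+ 2) (mulr_ge0 Kx0 (ltW (exprn_gt0 2 B0))).
have KmB0 : 0 <= Km * B by rewrite mulr_ge0 ?(ltW B0) //; clear -Km1; lra.
have [M [M1 eM lM1 lM2]] := nat_near_expR KmB0.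
pose l : R := ln N%:R.
have l0 : 0 <= l by apply: ln_ge0.
(* Up to rounding the windows use a quarter of ln N; [lbig] reserves half of it for ln M, ln X and
   the roundings. *)
pose I := (Num.truncn (l / (4 * LW))).+1.
have LW4 : 0 < 4 * LW by rewrite mulr_gt0.
have I1 : l <= I%:R * (4 * LW) by rewrite -ler_pdivrMr // ltW // truncnS_gt.
have I2 : I%:R * LW <= l / 4 + LW.
  have H : I%:R <= l / (4 * LW) + 1.
    by rewrite /I -natr1 lerD2r truncn_le divr_ge0 // ltW.
  apply: le_trans (ler_wpM2r (ltW LW0) H) _.
  have -> : (l / (4 * LW) + 1) * LW = l / 4 + LW by field; rewrite gt_eqF.
  by [].
have lbig : 2 * (Km + Kx + LW + 2) * B ^+ 2 <= l.
  apply: le_trans lN; apply: ler_pM => //; clear -Km1 Kx0 LW0 B21; lra.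
apply: (@gap_contradiction R c kap eps tau delta r K1 K2 B (sig * N%:R) N N' X M W I) => //.
- exact: ltW.
- by rewrite tau_le1 ltW.
- rewrite (ltW de0) /=; clear -deltaE KB41 de0; nra.
- by rewrite /kap mulrC -{1}[c]mulr1 -mulrDr.
- apply: le_trans eM; rewrite ler_expR; clear -Km1 B0; nra.
- have H : Kx * B ^+ 2 <= X%:R.
    by apply: le_trans eX; have := expR_ge1Dx (Kx * B ^+ 2); clear; lra.
  apply: le_trans (ler_wpM2l (ltW k0) H); apply: le_trans Kx2 _.
  have -> : kap * (Kx * B ^+ 2) = kap * B * Kx * B by ring.
  rewrite -[leLHS]mulr1; apply: ler_pM => //; first by rewrite mulr_ge0 // ltW.
  by apply: ler_wpM2r.
- apply: le_trans Kx1 (le_trans _ (ler_wpM2l (ltW tau_gt0) lX1)).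
  by rewrite mulrCA [leRHS]mulrC; apply: ler_wpM2r.
- exact: ltnW.
- have H : Km * B <= M%:R.
    by apply: le_trans eM; have := expR_ge1Dx (Km * B); clear; lra.
  apply: le_trans (ler_wpM2l (ltW k0) H); apply: le_trans (_ : _ <= 3 + c0) _; first by clear -cc; lra.
  apply: le_trans Km2 _; have -> : kap * (Km * B) = kap * B * Km by ring.
  by apply: ler_wpM2r => //; clear -Km1; lra.
- apply: le_trans cW; by clear -cc cp c01; nra.
- rewrite leq_divRL ?(ltnW X1) // -(ler_nat R) !natrM natrX.
  have M0 : 0 < M%:R :> R by rewrite ltr0n ltnW.
  have X0 : 0 < X%:R :> R by rewrite ltr0n ltnW.
  have WI0 : 0 < W%:R ^+ I :> R by rewrite exprn_gt0 // ltr0n.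
  rewrite -ler_ln ?posrE ?mulr_gt0 //; last by rewrite ltr0n.
  rewrite !lnM ?posrE ?mulr_gt0 // (lnXn I) ?ltr0n // -[ln W%:R *+ _]mulr_natl.
  rewrite -/LW -/l.
  have H : Km * B <= Km * B ^+ 2 by apply: ler_wpM2l => //; clear -Km1; lra.
  have H' : LW <= LW * B ^+ 2 by rewrite -{1}[LW]mulr1 ler_pM2l.
  by clear -I2 lM2 lX2 lbig H H' B21 l0; lra.
- rewrite -/l mulrAC; apply: ler_wpM2r => //.
  have h1 : delta * l <= tau * l.
    apply: ler_wpM2r => //.
    rewrite -(ler_pM2r (lt_le_trans ltr01 B41)).
    apply: le_trans (_ : _ <= tau0 * B ^+ 2) _; last first.
      rewrite B4 [leRHS]mulrA; apply: ler_wpM2r => //; clear -B21; lra.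
    have -> : delta * B ^+ 4 = K^-1.
      by rewrite /delta invfM -mulrA mulVf ?mulr1 // gt_eqF //; clear -B41; lra.
    apply: le_trans (_ : _ <= tau0) _.
      by rewrite -[leLHS]mul1r ler_pdivrMr //; clear -K1'; lra.
    by rewrite -{1}[tau0]mulr1 ler_pM2l.
  have h2 : K2 * (1 + ln X%:R) <= tau * l.
    apply: le_trans (_ : _ <= K2 * (2 + Kx) * B ^+ 2) _.
      rewrite -mulrA; apply: ler_wpM2l; first by clear -K21; lra.
      clear -lX2 B21; lra.
    apply: le_trans (_ : _ <= tau0 * K * B ^+ 2) _.
      by apply: ler_wpM2r => //; clear -B21; lra.
    apply: le_trans (ler_wpM2l (ltW tau_gt0) lN).
    have -> : tau * (K * B ^+ 4) = tau * B ^+ 2 * (K * B ^+ 2) by rewrite B4; ring.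
    rewrite -mulrA; apply: ler_wpM2r => //.
    by rewrite mulr_ge0 //; [clear -K1'|clear -B21]; lra.
  have h3 : 3 * tau * l <= sig * I%:R.
    rewrite -tauE; have -> : tau * (12 * LW) * I%:R = 3 * tau * (I%:R * (4 * LW)) by ring.
    by apply: ler_wpM2l => //; rewrite mulr_ge0 ?(ltW tau_gt0).
  by clear -h1 h2 h3; lra.
rewrite mulrAC ltr_pM2r ?ltr0n //.
by rewrite -[ltRHS]sigE ltr_pM2l // ltr_pM2l //; clear; lra.
Qed.

(** The same [K] and [theta] serve all lengths up to [c0], which is what allows iteration. [K] is a
    sum of nonnegative terms, each securing one of the lower bounds demanded of it. *)
Lemma psi_dense_step c0 : 1 <= c0 -> exists K theta, [/\ 1 <= K, 0 < theta, theta <= 1 &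
  forall c B, 0 < c -> c <= c0 -> 1 <= B -> 1 <= c * B ->
    psi_dense (c * (1 + theta)) B -> psi_dense c (K * B ^+ 4)].
Proof.
move=> c01; pose r := 3 + c0.
have r1 : 1 <= r by rewrite /r; lra.
have r21 : 1 <= 2 * r by lra.
have [K1 K11 short] := psi_short_interval r21.
have [K2 K21 avg] := sum_deficit_le r1.
have q100 : 0 < 100 * (4 + c0) by lra.
pose theta := (100 * (4 + c0))^-1.
have thetaE : theta * (100 * (4 + c0)) = 1 by rewrite mulVf // gt_eqF.
have th0 : 0 < theta by rewrite invr_gt0.
have th1 : theta <= 1 / 400 by clear -thetaE th0 c01; nra.
have W0' : 0 <= 50 * (3 + c0) * (2 + 2 * c0) by rewrite !mulr_ge0 //; lra.
pose W := (Num.truncn (50 * (3 + c0) * (2 + 2 * c0))).+1.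
have cW : 50 * (3 + c0) * (2 + 2 * c0) <= W%:R by apply: ltW; apply: truncnS_gt.
pose LW : R := ln W%:R.
have LW1 : 1 / 2 <= LW.
  have /andP[l2 _] := ln2_bounds R; apply: le_trans l2 _.
  by rewrite ler_ln ?posrE ?ltr0n //; apply: le_trans cW; nra.
have LW0 : 0 < LW by lra.
pose tau0 := theta / (480 * LW * (4 + c0)).
have d0 : 0 < 480 * LW * (4 + c0) by rewrite !mulr_gt0 //; lra.
have tau00 : 0 < tau0 by rewrite divr_gt0.
pose Kx := (K1 + 2) / tau0 + 80 / theta.
have Kx1 : K1 + 2 <= tau0 * Kx.
  have -> : tau0 * Kx = (K1 + 2) + tau0 * (80 / theta) by rewrite /Kx; field; rewrite !gt_eqF.
  by rewrite lerDl mulr_ge0 ?divr_ge0 // ltW.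
have Kx2 : 80 <= theta * Kx.
  have -> : theta * Kx = theta * ((K1 + 2) / tau0) + 80 by rewrite /Kx; field; rewrite !gt_eqF.
  by rewrite lerDr mulr_ge0 ?divr_ge0 ?ltW //; lra.
have Kx0 : 0 <= Kx by rewrite -(pmulr_rge0 _ th0); lra.
pose Km := (3 + c0) / theta + 1.
have Km1 : 1 <= Km by rewrite lerDr divr_ge0 ?ltW //; lra.
have Km2 : 3 + c0 <= theta * Km.
  have -> : theta * Km = 3 + c0 + theta by rewrite /Km; field; rewrite gt_eqF.
  by rewrite lerDl ltW.
pose K := 1 + 1 / tau0 + K2 * (2 + Kx) / tau0 + 2 * (Km + Kx + LW + 2).
have t1 : 0 <= 1 / tau0 by rewrite divr_ge0 ?ltW.
have t2 : 0 <= K2 * (2 + Kx) / tau0.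
  by rewrite divr_ge0 ?(ltW tau00) ?mulr_ge0 //; lra.
have KA : 1 <= tau0 * K.
  have : 1 / tau0 <= K by rewrite /K; clear -t1 t2 Km1 Kx0 LW0; lra.
  by rewrite ler_pdivrMr // [tau0 * K]mulrC.
have KB : K2 * (2 + Kx) <= tau0 * K.
  have : K2 * (2 + Kx) / tau0 <= K by rewrite /K; clear -t1 t2 Km1 Kx0 LW0; lra.
  by rewrite ler_pdivrMr // [tau0 * K]mulrC.
have KC : 2 * (Km + Kx + LW + 2) <= K by rewrite /K; clear -t1 t2 Km1 Kx0 LW0; lra.
have K1' : 1 <= K by clear -KC Km1 Kx0 LW0; lra.

exists K, theta; split => //; first by clear -th1; lra.
move=> c B cp cc B1 cB dense.
by apply: (@psi_dense_step_core c0 r K1 K2 W theta tau0 Kx Km K).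
Qed.

End Thresholds.

(** * Primes in short intervals *)

Section PrimeGaps.
Variable R : realType.
Implicit Types (M N n d k a b m j p q : nat) (x y c B : R).

Local Notation Lam := (Mangoldt R).
Local Notation psi := (psi R).
Local Notation psi_dense := (@psi_dense R).

(** Mertens' bounds leave an uncertainty of 1 + 7/4, so a logarithmic length of 5 makes the Mertens
    sum over (a, b] exceed 1, and every n there is larger than a. *)
Lemma psi_dense_base : psi_dense (expR 5) 1.
Proof.
move=> a b; rewrite mul1r => ea ab.
have a0R : 0 < a%:R :> R by apply: lt_le_trans ea; apply: expR_gt0.
have a0 : (0 < a)%N by rewrite -(ltr0n R).
have eb : expR 5 * a%:R <= b%:R :> R.
  by apply: le_trans ab; rewrite ler_pM2r // lerDr.
have e1 : 1 <= expR 5 :> R by have := expR_ge1Dx (5 : R); lra.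
have ab' : (a <= b)%N.
  by rewrite -(ler_nat R); apply: le_trans eb; rewrite -{1}[a%:R]mul1r ler_pM2r.
have b0 : (0 < b)%N by apply: leq_trans ab'.
have lb : 5 + ln a%:R <= ln (b%:R : R).
  have -> : 5 = ln (expR 5) :> R by rewrite expRK.
  by rewrite -lnM ?posrE ?expR_gt0 // ler_ln ?posrE ?mulr_gt0 ?expR_gt0 ?ltr0n.
have /andP[Hb _] := Mertens_bounds R b0.
have /andP[_ Ha] := Mertens_bounds R a0.
have H : a%:R * (Mertens_sum R b - Mertens_sum R a) <= psi b - psi a.
  have split_at (F : nat -> R) : \sum_(1 <= n < b.+1) F n - \sum_(1 <= n < a.+1) F n
      = \sum_(a.+1 <= n < b.+1) F n.
    by rewrite (@big_cat_nat _ _ _ a.+1) //= addrAC subrr add0r.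
  rewrite /Mertens_sum /psi !split_at mulr_sumr; apply: ler_sum_nat => n /andP[an _].
  have n0 : 0 < n%:R :> R by rewrite ltr0n; apply: leq_trans an.
  rewrite mulrCA -[leRHS]mulr1 ler_wpM2l ?Mangoldt_ge0 // ler_pdivrMr // mul1r ler_nat.
  exact: ltnW.
apply: le_trans H; rewrite -{1}[a%:R]mulr1 ler_pM2l //.
clear -lb Hb Ha; lra.
Qed.

Lemma psi_dense_weaken c B B' : 0 <= c -> B <= B' -> psi_dense c B -> psi_dense c B'.
Proof.
move=> c0 BB dense a b ea ab.
have ab' : (a <= b)%N.
  rewrite -(ler_nat R); apply: le_trans ab; rewrite -{1}[a%:R]mul1r.
  by apply: ler_wpM2r => //; lra.
apply: le_trans (dense a b _ ab) _; last first.
  by apply: ler_wpM2r => //; rewrite subr_ge0 psi_le.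
by apply: le_trans ea; rewrite ler_expR.
Qed.

(** The exponent 5 in place of 4 leaves one factor B to absorb K <= q <= B. *)
Lemma psi_dense_iterate : exists c0 theta q0, [/\ 1 <= c0, 0 < theta &
  forall q j, (q0 <= q)%N -> psi_dense (c0 / (1 + theta) ^+ j) (q%:R ^+ (5 ^ j))].
Proof.
have e1 : 1 <= expR 5 :> R by have := expR_ge1Dx (5 : R); lra.
have [K [theta [K1 th0 th1 step]]] := psi_dense_step e1.
exists (expR 5), theta, (Num.truncn K + 2)%N; split => // q j q0.
have Kq : K <= q%:R.
  apply: ltW; apply: lt_le_trans (truncnS_gt K) _; rewrite ler_nat.
  by apply: leq_trans q0; rewrite addn2.
have q2 : 2 <= q%:R :> R.
  by rewrite (ler_nat R 2); apply: leq_trans q0; rewrite leq_addl.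
have th10 : 0 < 1 + theta by lra.
(* The lower bound 2 is halved at worst when c is divided by 1 + theta <= 2, which leaves the
   hypothesis 1 <= c B of the next reduction; the factor B^4 restores it. *)
suff [] : psi_dense (expR 5 / (1 + theta) ^+ j) (q%:R ^+ (5 ^ j))
  /\ 2 <= expR 5 / (1 + theta) ^+ j * q%:R ^+ (5 ^ j) by [].
elim: j => [|j [dense big]].
  rewrite expn0 expr0 divr1 expr1; split; last by nra.
  by apply: psi_dense_weaken psi_dense_base; [apply: expR_ge0|lra].
set B := q%:R ^+ (5 ^ j) in dense big *.
set cj := expR 5 / (1 + theta) ^+ j in dense big *.
set c := expR 5 / (1 + theta) ^+ j.+1.
have c0 : 0 < c by rewrite divr_gt0 ?expR_gt0 ?exprn_gt0.
have cE : c * (1 + theta) = cj.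
  by rewrite /c /cj exprSr invfM mulrA mulfVK // gt_eqF.
have qB : q%:R <= B.
  by rewrite /B -[leLHS]expr1 ler_weXn2l ?expn_gt0 //; lra.
have B2 : 2 <= B by lra.
have cB : 1 <= c * B.
  have : 2 <= c * B * (1 + theta) by rewrite mulrAC cE.
  have : 0 < c * B by apply: mulr_gt0 => //; lra.
  clear -th1; nra.
have cc0 : c <= expR 5.
  rewrite ler_pdivrMr ?exprn_gt0 // ler_peMr ?expR_ge0 //.
  by apply: exprn_ege1; lra.
have BE : q%:R ^+ (5 ^ j.+1) = B * B ^+ 4 by rewrite expnSr exprM -exprS.
have B4 : 0 < B ^+ 4 by rewrite exprn_gt0 //; lra.
have B41 : 2 <= B ^+ 4.
  by apply: (le_trans B2); rewrite -[leLHS]expr1; apply: ler_weXn2l => //; clear -B2; lra.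
rewrite BE; split.
  apply: (@psi_dense_weaken c (K * B ^+ 4)); first exact: ltW.
    by rewrite ler_pM2r //; lra.
  by apply: step => //; [lra|rewrite cE].
rewrite mulrA; clear -cB B41; nra.
Qed.

(** Only powers p^k with k >= 2 contribute; they have p <= sqrt b and k <= 2 ln b, as ln 2 >= 1/2,
    and each contributes at most ln b. *)
Lemma psi_no_prime_le a b : (forall n, (a < n <= b)%N -> ~~ prime n) -> (0 < a <= b)%N ->
  psi b - psi a <= 2 * Num.sqrt b%:R * (2 * ln b%:R + 1) * ln b%:R.
Proof.
move=> noprime /andP[a0 ab].
have b0 : (0 < b)%N by apply: leq_trans ab.
have b0R : 0 < b%:R :> R by rewrite ltr0n.
have lb0 : 0 <= ln (b%:R : R) by apply: ln_ge0; rewrite ler1n.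
have sb1 : 1 <= Num.sqrt (b%:R : R) by rewrite -[leLHS]sqrtr1 ler_wsqrtr // ler1n.
pose s := Num.truncn (Num.sqrt (b%:R : R)).
pose L := Num.truncn (2 * ln (b%:R : R)).
have sle : s%:R <= Num.sqrt (b%:R : R) by rewrite truncn_le sqrtr_ge0.
have Lle : L%:R <= 2 * ln (b%:R : R) by rewrite truncn_le mulr_ge0.
have -> : psi b - psi a = \sum_(a.+1 <= n < b.+1) Lam n.
  by rewrite /psi (@big_cat_nat _ _ _ a.+1) //= addrAC subrr add0r.
(* Each contributing n has some pair (p, k) and each pair fits at most one n, so after exchanging
   the sums it is enough to count pairs. *)
apply: le_trans (_ : _ <= \sum_(a.+1 <= n < b.+1) \sum_(0 <= p < s.+1)
   \sum_(0 <= k < L.+1) (if n == (p ^ k)%N then ln (b%:R : R) else 0)) _.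
  apply: ler_sum_nat => n /andP[an nb].
  have nonneg (G : nat -> nat -> bool) r1 r2 : 0 <= \sum_(p <- r1) \sum_(k <- r2)
      (if G p k then ln (b%:R : R) else 0).
    by apply: sumr_ge0 => p _; apply: sumr_ge0 => k _; case: ifP.
  have [->|/Mangoldt_prime_power[p [k [pp k0 nE LE]]]] := eqVneq (Lam n) 0.
    exact: nonneg.
  have k2 : (2 <= k)%N.
    have := noprime n; rewrite an -ltnS nb => /(_ isT); rewrite nE.
    by case: k k0 nE => [//|[|//]] _ _; rewrite expn1 pp.
  have n0 : (0 < n)%N by apply: leq_trans an.
  have nbR : n%:R <= b%:R :> R by rewrite ler_nat.
  have ps : (p < s.+1)%N.
    rewrite -(ltr_nat R); apply: le_lt_trans (truncnS_gt _).
    rewrite -(ger0_norm (ler0n R p)) -sqrtr_sqr ler_wsqrtr //.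
    by apply: le_trans nbR; rewrite nE -natrX ler_nat leq_pexp2l ?prime_gt0.
  have kL : (k < L.+1)%N.
    rewrite -(ltr_nat R); apply: le_lt_trans (truncnS_gt _).
    have /andP[l2 _] := ln2_bounds R.
    have : ln (2 ^+ k : R) <= ln b%:R.
      rewrite ler_ln ?posrE ?exprn_gt0 //; apply: le_trans nbR.
      by rewrite nE -natrX ler_nat leq_exp2r // prime_gt1.
    rewrite lnXn // -[_ *+ k]mulr_natl.
    have : 0 <= k%:R :> R by []. clear -l2; nra.
  apply: le_trans (Mangoldt_le_ln R n) _.
  apply: le_trans (_ : ln (n%:R : R) <= ln b%:R) _.
    by rewrite ler_ln ?posrE ?ltr0n.
  rewrite (bigD1_seq p) ?mem_index_iota ?iota_uniq //=.
  rewrite (bigD1_seq k) ?mem_index_iota ?iota_uniq //= nE eqxx -addrA lerDl.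
  rewrite addr_ge0 ?nonneg //; first by apply: sumr_ge0 => i _; case: ifP.
  by apply: sumr_ge0 => i _; apply: sumr_ge0 => i' _; case: ifP.
rewrite exchange_big /=.
apply: le_trans (_ : _ <= \sum_(0 <= p < s.+1) \sum_(0 <= k < L.+1) ln (b%:R : R)) _.
  apply: ler_sum => p _; rewrite exchange_big /=; apply: ler_sum => k _.
  rewrite -big_mkcond /= big_const_seq iter_addr_0.
  rewrite (count_uniq_mem _ (iota_uniq _ _)).
  by case: (_ \in _); rewrite ?mulr1n ?mulr0n.
rewrite !big_const_nat !iter_addr_0 !subn0 -mulrnA -[leLHS]mulr_natl natrM.
rewrite -!natr1; apply: ler_wpM2r => //.
by rewrite mulrC; apply: ler_pM; rewrite ?addr_ge0 //; lra.
Qed.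

(** Without primes the mass is of order sqrt a (ln a)^2, against a/B >= a / ln a. With l = ln a and
    t = sqrt a = exp (l/2) this reads t <= 24 l^3, whereas t >= (l/2)^4 / 24; hence l <= 24 * 384 =
    9216, below 42 * 400. *)
Lemma prime_in_short_interval c B a b : 42 * 400 <= B -> 0 < c ->
  psi_dense c B -> expR B <= a%:R -> (1 + c) * a%:R <= b%:R -> b%:R <= 3 * a%:R :> R ->
  exists2 p, prime p & (a < p <= b)%N.
Proof.
move=> Bbig c0 dense ea ab ba.
have [/hasP[p]|/hasPn none] := boolP (has prime (index_iota a.+1 b.+1)).
  by rewrite mem_index_iota ltnS => apb pp; exists p.
exfalso.
have a0R : 0 < a%:R :> R by apply: lt_le_trans ea; apply: expR_gt0.
have a0 : (0 < a)%N by rewrite -(ltr0n R).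
have ab' : (0 < a <= b)%N.
  rewrite a0 -(ler_nat R); apply: le_trans ab; rewrite -[leLHS]mul1r ler_pM2r //.
  by clear -c0; lra.
have H : psi b - psi a <= 2 * Num.sqrt b%:R * (2 * ln b%:R + 1) * ln b%:R.
  apply: psi_no_prime_le => // n anb; apply: none.
  by rewrite mem_index_iota.
have D := dense a b ea ab.
have Bl : B <= ln (a%:R : R) by rewrite -[leLHS]expRK ler_ln ?posrE ?expR_gt0.
have /andP[_ lb] := ln_ratio_bounds ab' ba.
set l := ln a%:R in Bl lb.
have l1 : 42 * 400 <= l by apply: le_trans Bl.
have la : a%:R = expR (l / 2) * expR (l / 2) :> R.
  by rewrite -expRD -splitr lnK.
set t := expR (l / 2) in la.
have t0 : 0 < t by apply: expR_gt0.
have sb : Num.sqrt (b%:R : R) <= 2 * t.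
  rewrite -[2 * t]ger0_norm ?mulr_ge0 ?(ltW t0) // -sqrtr_sqr ler_wsqrtr //.
  apply: (le_trans ba); rewrite la; clear -t0; nra.
have lb0 : 0 <= ln (b%:R : R) by apply: ln_ge0; rewrite ler1n; case/andP: ab' => /leq_trans h /h.
have psi0 : 0 <= psi b - psi a by rewrite subr_ge0 psi_le //; case/andP: ab'.
have l0 : 0 < l by clear -l1; lra.
have step1 : t * t <= l * (4 * t * (3 * l) * (2 * l)).
  rewrite -la; apply: (le_trans D).
  apply: ler_pM => //; first by clear -Bbig; lra.
  apply: (le_trans H); apply: ler_pM => //.
  - by rewrite !mulr_ge0 ?sqrtr_ge0 // addr_ge0 ?mulr_ge0.
  - apply: ler_pM; rewrite ?mulr_ge0 ?sqrtr_ge0 ?addr_ge0 ?mulr_ge0 //.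
      by clear -sb; lra.
    by clear -lb l1; lra.
  - by clear -lb l1; lra.
have step2 : t <= 24 * (l * l * l).
  rewrite -(ler_pM2r t0); apply: (le_trans step1).
  by rewrite le_eqVlt; apply/orP; left; apply/eqP; ring.
have step3 : (l / 2) ^+ 4 / 24 <= t.
  have := @expR_ge1Dxn R (l / 2) 3; rewrite divr_ge0 ?(ltW l0) // => /(_ isT).
  have -> : (4`!)%:R = 24 :> R by [].
  by rewrite -/t; clear; lra.
have : (l / 2) ^+ 4 / 24 = l * (l * l * l) / 384 by field.
have : 0 < l * l * l by rewrite !mulr_gt0.
move: step2 step3; set v := l * l * l => s2 s3 v0 E.
have : l * v <= 24 * 384 * v by clear -s2 s3 E; lra.
rewrite ler_pM2r //; clear -l1; lra.
Qed.


Lemma expn_ge_mul m y : 2 <= y -> (0 < m)%N -> y * m%:R <= y ^+ m.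
Proof.
move=> y2; case: m => // m _; elim: m => [|m IH]; first by rewrite mulr1 expr1.
rewrite exprS ler_pM2l; last by lra.
apply: le_trans IH; rewrite -natr1.
have : 1 <= m.+1%:R :> R by rewrite ler1n.
clear -y2; nra.
Qed.

End PrimeGaps.

(** [J] reductions divide c by at least 8 c0, and J m of them by (8 c0)^m >= 8 c0 m, so c <= 1/(8m).
    The other half of the allowed 1/(4m) pays for the rounding of [b], as 1 <= n/(8m). *)
Lemma prime_gap (R : realType) : exists E : nat, (1 < E)%N /\
  forall m n : nat, (0 < m)%N -> (E ^ (E ^ (E ^ m)) <= n)%N ->
  exists2 p, prime p & (n < p)%N && (4 * m * p <= (4 * m + 1) * n)%N.
Proof.
have [c0 [theta [q0 [c01 th0 dense]]]] := psi_dense_iterate R.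
have [J HJ] : exists J, 8 * c0 <= (1 + theta) ^+ J.
  pose J := (Num.truncn (8 * c0 / theta)).+1; exists J.
  have HJ : 8 * c0 <= theta * J%:R.
    by rewrite [leRHS]mulrC -ler_pdivrMr //; apply: ltW; apply: truncnS_gt.
  apply: (le_trans HJ).
  have bernoulli k : 1 + theta * k%:R <= (1 + theta) ^+ k.
    elim: k => [|k IH]; first by rewrite mulr0 addr0 expr0.
    rewrite exprS; have k0 : 0 <= k%:R :> R by [].
    have H : (1 + theta) * (1 + theta * k%:R) <= (1 + theta) * (1 + theta) ^+ k.
      by apply: ler_wpM2l => //; clear -th0; lra.
    apply: (le_trans _ H); rewrite -natr1.
    have : 0 <= theta * (theta * k%:R) by rewrite !mulr_ge0 // ltW.
    by clear; lra.
  by apply: le_trans (bernoulli J); rewrite lerDr.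
pose q := (q0 + 42 * 400)%N.
pose E := (q + 5 ^ J + 3)%N.
have E1 : (1 < E)%N by rewrite /E addn3.
exists E; split => //.
move=> m n m0 nE.
pose j := (J * m)%N.
set B : R := q%:R ^+ (5 ^ j).
set c := c0 / (1 + theta) ^+ j.
have th10 : 0 < 1 + theta by clear -th0; lra.
have cp : 0 < c by rewrite divr_gt0 ?exprn_gt0 //; clear -c01; lra.
have mR : 1 <= m%:R :> R by rewrite ler1n.
have cm : c * (8 * m%:R) <= 1.
  rewrite /c mulrAC ler_pdivrMr ?exprn_gt0 // mul1r exprM.
  have y2 : 2 <= 8 * c0 by clear -c01; lra.
  have := expn_ge_mul y2 m0; rewrite mulrCA mulrA => /le_trans; apply.
  by rewrite lerXn2r ?nnegrE ?exprn_ge0 //; [clear -c01|clear -th0]; lra.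
have q1 : (1 <= q)%N by rewrite /q addn_gt0 orbT.
have qR1 : 1 <= q%:R :> R by rewrite ler1n.
have Bbig : 42 * 400 <= B.
  apply: (le_trans (_ : _ <= q%:R)); first by rewrite -natrM ler_nat leq_addl.
  by rewrite /B -[leLHS]expr1; apply: ler_weXn2l; rewrite ?expn_gt0.
have qE : (q <= E)%N by rewrite /E -addnA leq_addr.
have JE : (5 ^ J <= E)%N by rewrite /E addnAC leq_addl.
have en : expR B <= n%:R.
  have BE : B <= (E ^ (E ^ m))%:R.
    rewrite /B -natrX ler_nat.
    apply: (@leq_trans (E ^ (5 ^ j))%N); first by rewrite leq_exp2r // expn_gt0.
    by rewrite leq_exp2l // /j expnM leq_exp2r.
  apply: (@le_trans _ _ (expR (E ^ (E ^ m))%:R)); first by rewrite ler_expR.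
  apply: (@le_trans _ _ (E ^ (E ^ (E ^ m)))%:R); last by rewrite ler_nat.
  rewrite -[_%:R]mulr1 expRM_natl natrX lerXn2r ?nnegrE ?expR_ge0 //.
  have e4 : expR 1 <= 4 :> R.
    have := expR_ge1Dx (- (1 / 2) : R); rewrite expRN.
    have -> : expR 1 = expR (1 / 2) * expR (1 / 2) :> R by rewrite -expRD; congr expR; lra.
    have := expR_gt0 (1 / 2 : R); set e := expR (1 / 2) => e0.
    have -> : 1 + - (1 / 2) = 2^-1 :> R by lra.
    by rewrite lef_pV2 ?posrE // => e2; clear -e0 e2; nra.
  apply: (le_trans e4); rewrite (ler_nat R 4) (leq_trans _ qE) // /q.
  by rewrite (leq_trans _ (leq_addl _ _)).
have nR : 8 * m%:R <= n%:R :> R.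
  rewrite -natrM ler_nat (leq_trans _ nE) //.
  have E8 : (8 <= E)%N by rewrite (leq_trans _ qE) // /q (leq_trans _ (leq_addl _ _)).
  apply: (@leq_trans (E * E ^ m)%N); first by rewrite leq_mul // ltnW // ltn_expl.
  rewrite -expnS leq_exp2l //.
  by apply: leq_trans (ltn_expl _ E1); rewrite ltnS ltnW // ltn_expl.
pose b := (Num.truncn ((1 + c) * n%:R)).+1.
have cb : (1 + c) * n%:R <= b%:R by apply: ltW; apply: truncnS_gt.
have bc : b%:R <= (1 + c) * n%:R + 1.
  by rewrite -natr1 lerD2r truncn_le mulr_ge0 // addr_ge0 // ltW.
have c1 : c <= 1 by clear -cm mR cp; nra.
have b3 : b%:R <= 3 * n%:R :> R by clear -bc c1 mR nR; nra.
have D : psi_dense c B by apply: dense; apply: leq_addr.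
have [p pp /andP[np pb]] := prime_in_short_interval Bbig cp D en cb b3.
exists p => //; rewrite np /= -(ler_nat R) !natrM natrD natrM.
have pR : p%:R <= (1 + c) * n%:R + 1 by apply: le_trans bc; rewrite ler_nat.
have H : c * (8 * m%:R) * n%:R <= n%:R by rewrite ler_piMl.
have : 4 * m%:R * p%:R <= 4 * m%:R * ((1 + c) * n%:R + 1).
  by apply: ler_wpM2l => //; rewrite mulr_ge0.
clear -H nR; lra.
Qed.

(** * Computability of the interpolated thresholds *)

Section Programs.
Variable phi : nat -> nat.
Local Open Scope nat_scope.
Implicit Types (xs : seq nat) (i j v : nat).

Lemma oeval_varE xs i v : v = nth 0 xs i -> oeval phi xs (OVar i) v.
Proof. by move=> ->; apply: oeval_var. Qed.

Lemma oeval_recE xs m a s l (u : nat -> nat) v :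
  oeval phi xs m l -> oeval phi xs a (u 0) ->
  (forall i, i < l -> oeval phi [:: u i, i & xs] s (u i.+1)) ->
  v = u l -> oeval phi xs (ORec m a s) v.
Proof. by move=> hm ha hs ->; apply: oeval_rec. Qed.

(** The step returns the loop counter, whose last value is the predecessor. *)
Definition pred_expr i := ORec (OVar i) OZero (OVar 1).
Definition sub_expr i j := ORec (OVar j) (OVar i) (pred_expr 0).
Definition add_expr i j := ORec (OVar j) (OVar i) (OSucc (OVar 0)).
Definition mul_expr i j := ORec (OVar j) OZero (add_expr 0 i.+2).
Definition pow_expr i j := ORec (OVar j) (OSucc OZero) (mul_expr 0 i.+2).
(** Based on the recursion (k + 1)./2 = k - k./2. *)
Definition half_expr i := ORec (OVar i) OZero (sub_expr 1 0).
Definition const_expr n := iter n OSucc OZero.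
(** The quotient of a by b is the least k with a + 1 <= (k + 1) b; the tested value is the truncated
    difference of the two sides. *)
Definition div_expr i j :=
  OMu (OLet (OSucc (OVar 0)) (OLet (mul_expr 0 j.+2)
    (OLet (OSucc (OVar i.+3)) (sub_expr 0 1)))).

Lemma oeval_pred xs i v : v = (nth 0 xs i).-1 -> oeval phi xs (pred_expr i) v.
Proof.
by apply: (oeval_recE (u := predn)) => [||k _]; [apply: oeval_var|apply: oeval_zero|apply: oeval_varE].
Qed.

Lemma oeval_sub xs i j v : v = nth 0 xs i - nth 0 xs j -> oeval phi xs (sub_expr i j) v.
Proof.
apply: (oeval_recE (u := fun k => nth 0 xs i - k)) => [||k _].
- exact: oeval_var.
- by apply: oeval_varE; rewrite subn0.
by apply: oeval_pred; rewrite /= subnS.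
Qed.

Lemma oeval_add xs i j v : v = nth 0 xs i + nth 0 xs j -> oeval phi xs (add_expr i j) v.
Proof.
apply: (oeval_recE (u := fun k => nth 0 xs i + k)) => [||k _].
- exact: oeval_var.
- by apply: oeval_varE; rewrite addn0.
by rewrite addnS; apply: oeval_succ; apply: oeval_varE.
Qed.

Lemma oeval_mul xs i j v : v = nth 0 xs i * nth 0 xs j -> oeval phi xs (mul_expr i j) v.
Proof.
apply: (oeval_recE (u := fun k => nth 0 xs i * k)) => [||k _].
- exact: oeval_var.
- by rewrite muln0; apply: oeval_zero.
by apply: oeval_add; rewrite /= mulnS addnC.
Qed.

Lemma oeval_pow xs i j v : v = nth 0 xs i ^ nth 0 xs j -> oeval phi xs (pow_expr i j) v.
Proof.
apply: (oeval_recE (u := fun k => nth 0 xs i ^ k)) => [||k _].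
- exact: oeval_var.
- by apply: oeval_succ; apply: oeval_zero.
by apply: oeval_mul; rewrite /= expnSr.
Qed.

Lemma oeval_half xs i v : v = (nth 0 xs i)./2 -> oeval phi xs (half_expr i) v.
Proof.
apply: (oeval_recE (u := half)) => [||k _].
- exact: oeval_var.
- exact: oeval_zero.
by apply: oeval_sub => /=; lia.
Qed.

Lemma oeval_const xs n : oeval phi xs (const_expr n) n.
Proof. by elim: n => [|n IH]; [apply: oeval_zero|apply: oeval_succ]. Qed.

Lemma oeval_div xs i j v : 0 < nth 0 xs j -> v = nth 0 xs i %/ nth 0 xs j ->
  oeval phi xs (div_expr i j) v.
Proof.
move=> b0 ->; set a := nth 0 xs i; set b := nth 0 xs j in b0 *.
have step k r : r = a.+1 - k.+1 * b -> oeval phi (k :: xs)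
    (OLet (OSucc (OVar 0)) (OLet (mul_expr 0 j.+2)
      (OLet (OSucc (OVar i.+3)) (sub_expr 0 1)))) r.
  move=> ->; apply: (@oeval_let _ _ _ _ k.+1).
    by apply: oeval_succ; apply: oeval_varE.
  apply: (@oeval_let _ _ _ _ (k.+1 * b)); first exact: oeval_mul.
  apply: (@oeval_let _ _ _ _ a.+1); last exact: oeval_sub.
  by apply: oeval_succ; apply: oeval_varE.
apply: (@oeval_mu _ _ _ _ (fun k => (a.+1 - k.+1 * b).-1)) => [k kl|].
  apply: step; rewrite prednK // subn_gt0 ltnS.
  by apply: leq_trans (leq_divM a b); rewrite leq_mul2r kl orbT.
by apply: step; apply/esym/eqP; rewrite subn_eq0 ltn_ceil.
Qed.

End Programs.

Section Interpolation.
Local Open Scope nat_scope.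
Variable E : nat.

Definition tower i := E ^ (E ^ (E ^ i)).

Definition tower_expr i :=
  OLet (OSucc (OSucc (OVar i))) (OLet (const_expr E)
    (OLet (pow_expr 0 1) (OLet (pow_expr 1 0) (pow_expr 2 0)))).

(** A crude Lipschitz constant of the interpolant on arguments up to [M]: the sum of the slopes of
    its ramps. *)
Definition height M := \sum_(0 <= i < M) tower i.+2.

(* [z] is a numerator over [s] of the argument, and the value is a numerator
   over [s] of the interpolant; [s - (s - t)] is the minimum of [s] and [t]. *)
Definition scaled_sum z s M :=
  \sum_(0 <= i < M) tower i.+2 * (s - (s - (z - i * s))).

Definition height_expr i :=
  ORec (OVar i) OZero (OLet (tower_expr 1) (add_expr 1 0)).

Definition scaled_sum_expr z s M :=
  ORec (OVar M) OZero (OLet (tower_expr 1) (OLet (mul_expr 2 s.+3)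
    (OLet (sub_expr z.+4 0) (OLet (sub_expr s.+4.+1 0) (OLet (sub_expr s.+4.+2 0)
      (OLet (mul_expr 4 0) (add_expr 6 0))))))).

Lemma oeval_tower phi xs i v : v = tower (nth 0 xs i).+2 -> oeval phi xs (tower_expr i) v.
Proof.
move=> ->; set k := nth 0 xs i.
apply: (@oeval_let _ _ _ _ k.+2); first by do 2 apply: oeval_succ; apply: oeval_var.
apply: (@oeval_let _ _ _ _ E); first exact: oeval_const.
apply: (@oeval_let _ _ _ _ (E ^ k.+2)); first exact: oeval_pow.
apply: (@oeval_let _ _ _ _ (E ^ (E ^ k.+2))); first exact: oeval_pow.
exact: oeval_pow.
Qed.

Lemma oeval_height phi xs i v : v = height (nth 0 xs i) -> oeval phi xs (height_expr i) v.
Proof.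
apply: (oeval_recE (u := height)) => [||k _].
- exact: oeval_var.
- by rewrite /height big_geq //; apply: oeval_zero.
apply: (@oeval_let _ _ _ _ (tower k.+2)); first exact: oeval_tower.
by apply: oeval_add; rewrite /height big_nat_recr.
Qed.

Lemma oeval_scaled_sum phi xs z s M v :
  v = scaled_sum (nth 0 xs z) (nth 0 xs s) (nth 0 xs M) ->
  oeval phi xs (scaled_sum_expr z s M) v.
Proof.
set Z := nth 0 xs z; set S := nth 0 xs s.
apply: (oeval_recE (u := scaled_sum Z S)) => [||k _].
- exact: oeval_var.
- by rewrite /scaled_sum big_geq //; apply: oeval_zero.
apply: (@oeval_let _ _ _ _ (tower k.+2)); first exact: oeval_tower.
apply: (@oeval_let _ _ _ _ (k * S)); first exact: oeval_mul.
apply: (@oeval_let _ _ _ _ (Z - k * S)); first exact: oeval_sub.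
apply: (@oeval_let _ _ _ _ (S - (Z - k * S))); first exact: oeval_sub.
apply: (@oeval_let _ _ _ _ (S - (S - (Z - k * S)))); first exact: oeval_sub.
apply: (@oeval_let _ _ _ _ (tower k.+2 * (S - (S - (Z - k * S))))); first exact: oeval_mul.
by apply: oeval_add; rewrite /scaled_sum big_nat_recr.
Qed.

(* The bound values are, in this order: an integer approximation of the argument, the
   cut-off of the sum, a Lipschitz constant [L], the working precision [p], 2 ^ p, the
   numerator of the argument over 2 ^ p, the sum, half the rounding divisor, the rounding
   divisor 2 ^ (L + 2), and the rounded quotient, whose double is its integer code. *)
Definition interpolant_expr : oexpr :=
  OLet (OLet (OQuery OZero) (half_expr 0))
  (OLet (OSucc (OSucc (OVar 0)))
  (OLet (height_expr 0)
  (OLet (OLet (add_expr 3 0) (OSucc (OSucc (OVar 0))))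
  (OLet (OLet (const_expr 2) (pow_expr 0 1))
  (OLet (OLet (OQuery (OVar 1)) (half_expr 0))
  (OLet (scaled_sum_expr 0 1 4)
  (OLet (OLet (const_expr 2) (OLet (OSucc (OVar 5)) (pow_expr 1 0)))
  (OLet (add_expr 0 0)
  (OLet (OLet (add_expr 2 1) (div_expr 0 1))
  (add_expr 0 0)))))))))).

(** The approximation [phi 0] has error at most 1, so the argument is at most M - 1. With precision
    j + L + 2 the input error, multiplied by L <= 2^L, is at most 2^-j / 4. Adding 2^(L+1), half the
    divisor, makes the division round to nearest, with error at most 2^-j / 2. *)
Definition interpolant_output (phi : nat -> nat) j :=
  let M := (phi 0)./2.+2 in
  let L := height M in
  let p := (j + L).+2 in
  ((scaled_sum (phi p)./2 (2 ^ p) M + 2 ^ L.+1) %/ 2 ^ L.+2).*2.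

Lemma oeval_interpolant phi j :
  oeval phi [:: j] interpolant_expr (interpolant_output phi j).
Proof.
rewrite /interpolant_output; set M := (phi 0)./2.+2; set L := height M; set p := (j + L).+2.
apply: (@oeval_let _ _ _ _ (phi 0)./2).
  apply: (@oeval_let _ _ _ _ (phi 0)); last exact: oeval_half.
  exact: (oeval_query (oeval_zero _ _)).
apply: (@oeval_let _ _ _ _ M).
  by rewrite /M; apply: oeval_succ; apply: oeval_succ; apply: oeval_varE.
apply: (@oeval_let _ _ _ _ L); first exact: oeval_height.
apply: (@oeval_let _ _ _ _ p).
  apply: (@oeval_let _ _ _ _ (j + L)); first exact: oeval_add.
  by rewrite /p; apply: oeval_succ; apply: oeval_succ; apply: oeval_varE.
apply: (@oeval_let _ _ _ _ (2 ^ p)).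
  by apply: (@oeval_let _ _ _ _ 2); [apply: oeval_const|apply: oeval_pow].
apply: (@oeval_let _ _ _ _ (phi p)./2).
  apply: (@oeval_let _ _ _ _ (phi p)); last exact: oeval_half.
  by apply: oeval_query; apply: oeval_varE.
apply: (@oeval_let _ _ _ _ (scaled_sum (phi p)./2 (2 ^ p) M)); first exact: oeval_scaled_sum.
apply: (@oeval_let _ _ _ _ (2 ^ L.+1)).
  apply: (@oeval_let _ _ _ _ 2); first exact: oeval_const.
  apply: (@oeval_let _ _ _ _ L.+1); first by apply: oeval_succ; apply: oeval_varE.
  exact: oeval_pow.
apply: (@oeval_let _ _ _ _ (2 ^ L.+2)); first by apply: oeval_add; rewrite /= addnn expnS mul2n.
apply: (@oeval_let _ _ _ _ ((scaled_sum (phi p)./2 (2 ^ p) M + 2 ^ L.+1) %/ 2 ^ L.+2)).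
  apply: (@oeval_let _ _ _ _ (scaled_sum (phi p)./2 (2 ^ p) M + 2 ^ L.+1)).
    exact: oeval_add.
  by apply: oeval_div; rewrite /= ?expn_gt0.
by apply: oeval_add; rewrite /= addnn.
Qed.

End Interpolation.

(** * The interpolating function and its computability *)

Section Interpolant.
Variables (R : realType) (E : nat).
Implicit Types (x y : R) (i j M : nat).

Definition clamp x : R := Num.min 1 (Num.max 0 x).

(** A function computable from names is continuous, which rules out the tower at the argument
    rounded up; each new tower is therefore added along a ramp of length 1. *)
Definition interpolant x : R :=
  \sum_(0 <= i < (Num.truncn x).+1) (tower E i.+2)%:R * clamp (x - i%:R).

Lemma clamp_eq0 x : x <= 0 -> clamp x = 0.
Proof. by rewrite /clamp; case: (leP 0 x) => h; case: (leP 1 _) => h' h''; lra. Qed.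

Lemma clamp_eq1 x : 1 <= x -> clamp x = 1.
Proof. by rewrite /clamp; case: (leP 0 x) => h; case: (leP 1 _) => h' h''; lra. Qed.

Lemma clamp_id x : 0 <= x <= 1 -> clamp x = x.
Proof. by move=> /andP[]; rewrite /clamp; case: (leP 0 x) => h; case: (leP 1 _) => h' h'' h3; lra. Qed.

Lemma clamp_ge0 x : 0 <= clamp x.
Proof. by rewrite /clamp; case: (leP 0 x) => h; case: (leP 1 _) => h'; lra. Qed.

Lemma clamp_lipschitz x y : `|clamp x - clamp y| <= `|x - y|.
Proof.
have H u v : clamp u - clamp v <= `|u - v|.
  have : u - v <= `|u - v| by apply: ler_norm.
  have : 0 <= `|u - v| by [].
  rewrite /clamp; case: (leP 0 u) => h1; case: (leP 1 _) => h2;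
    case: (leP 0 v) => h3; case: (leP 1 _) => h4; lra.
by rewrite ler_norml lerNl opprB H distrC H.
Qed.

(** Ramps starting beyond [x] contribute 0, so any integer upper bound may end the sum; the exact
    integer part of [x] could not be computed from a name. *)
Lemma interpolant_cutoff x M : x <= M%:R ->
  interpolant x = \sum_(0 <= i < M) (tower E i.+2)%:R * clamp (x - i%:R).
Proof.
have widen M1 M2 : (M1 <= M2)%N -> x <= M1%:R ->
    \sum_(0 <= i < M1) (tower E i.+2)%:R * clamp (x - i%:R)
    = \sum_(0 <= i < M2) (tower E i.+2)%:R * clamp (x - i%:R).
  move=> M12 xM; rewrite [RHS](@big_cat_nat _ _ _ M1) //=.
  rewrite [X in _ = _ + X]big_nat_cond [X in _ = _ + X]big1 ?addr0 //.
  move=> i /andP[/andP[Mi _] _]; rewrite clamp_eq0 ?mulr0 // subr_le0.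
  by apply: le_trans xM _; rewrite ler_nat.
move=> xM; have xT : x <= (Num.truncn x).+1%:R by apply/ltW/truncnS_gt.
by rewrite /interpolant (widen _ _ (leq_maxl _ M) xT) -(widen _ _ (leq_maxr _ M) xM).
Qed.

Lemma interpolant_lipschitz x y M : x <= M%:R -> y <= M%:R ->
  `|interpolant x - interpolant y| <= (height E M)%:R * `|x - y|.
Proof.
move=> xM yM; rewrite (interpolant_cutoff xM) (interpolant_cutoff yM) -sumrB.
apply: (le_trans (ler_norm_sum _ _ _)).
rewrite /height natr_sum mulr_suml; apply: ler_sum => i _.
rewrite -mulrBr normrM normr_nat ler_wpM2l //.
apply: (le_trans (clamp_lipschitz _ _)).
by rewrite opprB addrA subrK.
Qed.

(** Ramps and integer coefficients preserve the denominator s, so evaluation at a dyadic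
    approximation is exact; only the input error and the final rounding remain. *)
Lemma interpolant_scaled z s M : (0 < s)%N -> (z <= M * s)%N ->
  interpolant (z%:R / s%:R) = (scaled_sum E z s M)%:R / s%:R.
Proof.
move=> s0 zM; have s0R : 0 < s%:R :> R by rewrite ltr0n.
rewrite (@interpolant_cutoff _ M); last by rewrite ler_pdivrMr // -natrM ler_nat.
rewrite /scaled_sum natr_sum mulr_suml; apply: eq_bigr => i _.
rewrite natrM -mulrA; congr (_ * _).
have -> : z%:R / s%:R - i%:R = (z%:R - (i * s)%:R) / s%:R :> R.
  by rewrite natrM mulrBl mulfK // gt_eqF.
have [zi|iz] := leqP z (i * s).
  rewrite clamp_eq0; last by rewrite pmulr_lle0 ?invr_gt0 // subr_le0 ler_nat.
  have -> : (z - i * s = 0)%N by apply/eqP; rewrite subn_eq0.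
  by rewrite subn0 subnn mul0r.
rewrite -natrB; last exact: ltnW.
have [zs|sz] := leqP (z - i * s) s.
  rewrite subKn // clamp_id // divr_ge0 //=.
  by rewrite ler_pdivrMr // mul1r ler_nat.
rewrite clamp_eq1; last by rewrite ler_pdivlMr // mul1r ler_nat ltnW.
have -> : (s - (z - i * s) = 0)%N by apply/eqP; rewrite subn_eq0 ltnW.
by rewrite subn0 divff // gt_eqF.
Qed.

(** With T the integer part of x, the ramp starting at T - 1 is complete and contributes the tower
    at T + 1 > x; hence the shift by two in the indices. *)
Lemma interpolant_ge x : 1 <= x -> exists2 m : nat, x <= m%:R &
  (tower E m)%:R <= interpolant x.
Proof.
move=> x1; have x0 : 0 <= x by lra.
have T0 : (0 < Num.truncn x)%N by rewrite truncn_gt0.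
have xT : x < (Num.truncn x).+1%:R by apply: truncnS_gt.
have Tx : (Num.truncn x)%:R <= x by rewrite truncn_le.
exists (Num.truncn x).+1; first exact: ltW.
rewrite /interpolant; case: (Num.truncn x) T0 xT Tx => // t _ xT Tx.
rewrite big_nat_recr //= big_nat_recr //= clamp_eq1; last first.
  by move: Tx; rewrite -natr1; lra.
rewrite mulr1 addrAC lerDr addr_ge0 //; last by rewrite mulr_ge0 // clamp_ge0.
by apply: sumr_ge0 => i _; rewrite mulr_ge0 // clamp_ge0.
Qed.

(** A negative code would put the approximation at least 2 away from x, while the error is at most
    1; so halving decodes correctly. *)
Lemma real_name_half phi x i : 2 <= x -> real_name phi x ->
  `|x - ((phi i)./2)%:R / 2 ^+ i| <= 2 ^- i.
Proof.
move=> x2 /(_ i); rewrite /int_decode; case: ifP => // _.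
set n := _./2; rewrite NegzE mulrNz mulNr opprK -pmulrn.
have p1 : 2 ^- i <= 1 :> R by rewrite invf_le1 ?exprn_gt0 // exprn_ege1 ?ler1n.
have : 0 <= n.+1%:R / 2 ^+ i :> R by rewrite divr_ge0 // exprn_ge0.
set w := _ / _ => w0 H; exfalso.
have : x + w <= `|x + w| by apply: ler_norm.
lra.
Qed.

Lemma interpolant_computable : computable_on [pred x : R | 2 <= x] interpolant.
Proof.
exists (interpolant_expr E) => x phi x2 name.
exists (interpolant_output E phi); split; last by move=> j; apply: oeval_interpolant.
move=> j; rewrite /interpolant_output /int_decode odd_double doubleK.
set M := (phi 0)./2.+2; set L := height E M; set p := (j + L).+2; set z := (phi p)./2.
have H0 := real_name_half 0 x2 name.
have Hp := real_name_half p x2 name.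
rewrite -/z in Hp; rewrite expr0 invr1 mulr1 in H0.
have sp : 0 < 2 ^+ p :> R by rewrite exprn_gt0.
have p1 : 2 ^- p <= 1 :> R by rewrite invf_le1 // exprn_ege1 ?ler1n.
have ME : M%:R = (phi 0)./2%:R + 2 :> R by rewrite /M -!natr1; lra.
have xM : x <= M%:R - 1 by move: H0; rewrite ler_norml ME => /andP[]; lra.
have zM : z%:R / 2 ^+ p <= M%:R :> R by move: Hp; rewrite ler_norml => /andP[]; lra.
have zMn : (z <= M * 2 ^ p)%N by rewrite -(ler_nat R) natrM natrX -ler_pdivrMr.
have := @interpolant_scaled z (2 ^ p) M; rewrite expn_gt0 => /(_ isT zMn).
rewrite natrX; set G := scaled_sum _ _ _ _ => GE.
have xM' : x <= M%:R by lra.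
have := interpolant_lipschitz xM' zM; rewrite GE -/L => lip.
set D := (2 ^ L.+2)%N; set t := (_ %/ _)%N.
have D0 : (0 < D)%N by rewrite expn_gt0.
have DE : D%:R = 4 * 2 ^+ L :> R by rewrite /D natrX !exprS; ring.
have hD : (2 ^ L.+1)%:R = 2 * 2 ^+ L :> R by rewrite natrX exprS.
have t1 : (t * D <= G + 2 ^ L.+1)%N by apply: leq_divM.
have t2 : (G + 2 ^ L.+1 < t.+1 * D)%N by apply: ltn_ceil.
have t1R : t%:R * D%:R <= G%:R + 2 * 2 ^+ L :> R by rewrite -natrM -hD -natrD ler_nat.
have t2R : G%:R + 2 * 2 ^+ L <= (t%:R + 1) * D%:R :> R.
  by rewrite natr1 -natrM -hD -natrD ler_nat ltnW.
have L2 : L%:R <= 2 ^+ L :> R by rewrite -natrX ler_nat ltnW // ltn_expl.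
have lip' : `|interpolant x - G%:R / 2 ^+ p| <= 2 ^- j / 4.
  apply: (le_trans lip).
  apply: (le_trans (_ : _ <= 2 ^+ L * 2 ^- p)).
    by apply: ler_pM.
  rewrite /p -addnS -addnS exprD invfM mulrCA !exprS.
  have l0 : 0 < 2 ^+ L :> R by rewrite exprn_gt0.
  have -> : 2 ^+ L * (2 * (2 * 2 ^+ L))^-1 = 4^-1 :> R by field; rewrite gt_eqF.
  by [].
have pE : 2 ^+ p = 2 ^+ j * D%:R :> R.
  by rewrite /p /D natrX -addnS -addnS exprD.
have j0 : 0 < 2 ^+ j :> R by rewrite exprn_gt0.
have D0R : 0 < D%:R :> R by rewrite ltr0n.
have round : `|G%:R / 2 ^+ p - t%:R / 2 ^+ j| <= 2 ^- j / 2 :> R.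
  have -> : G%:R / 2 ^+ p - t%:R / 2 ^+ j = (G%:R - t%:R * D%:R) / D%:R / 2 ^+ j :> R.
    by rewrite pE; field; rewrite !gt_eqF.
  rewrite normrM [`|(2 ^+ j)^-1|]ger0_norm ?invr_ge0 ?(ltW j0) //.
  rewrite [leLHS]mulrC ler_pM2l ?invr_gt0 //.
  rewrite normrM [`|D%:R^-1|]ger0_norm ?invr_ge0 // ler_pdivrMr //.
  by rewrite ler_norml; apply/andP; split; rewrite DE; move: t1R t2R; rewrite DE; lra.
have -> : interpolant x - (Posz t)%:~R / 2 ^+ j
  = (interpolant x - G%:R / 2 ^+ p) + (G%:R / 2 ^+ p - t%:R / 2 ^+ j).
  by rewrite -pmulrn; ring.
apply: (le_trans (ler_normD _ _)); apply: (le_trans (lerD lip' round)).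
have : 0 < 2 ^- j :> R by rewrite invr_gt0.
lra.
Qed.

End Interpolant.

(** The gap bound is applied at n and again at the prime p found there. Both primes exceed n, which
    settles the lower bounds. With x = 1/(4m) and m >= k, the upper bound follows from (1 + x)^2 <=
    1 + 3x < 1 + 1/(k - 1). *)
Theorem theorem34 (R : realType) :
  exists C : R -> R,
    computable_on [pred k : R | 2 <= k] C /\
    forall k : R, 2 <= k ->
    forall n : int, C k < n%:~R ->
    exists p q : nat,
      [/\ prime p, prime q, p <> q,
          (k - 1) / k * n%:~R < p%:R < k / (k - 1) * n%:~R &
          (k - 1) / k * n%:~R < q%:R < k / (k - 1) * n%:~R].
Proof.
have [E [E1 gap]] := prime_gap R.
exists (interpolant E); split; first exact: interpolant_computable.
move=> k k2 n Cn.
have k1 : 1 <= k by lra.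
have [m km tC] := interpolant_ge E k1.
have m0R : 0 < m%:R :> R by lra.
have m0 : (0 < m)%N by rewrite -(ltr0n R).
have tn := le_lt_trans tC Cn.
have t0 : (0 < tower E m)%N by rewrite expn_gt0 (ltnW E1).
case: n Cn tn => [n|n] Cn tn; last first.
  have : 0 <= (tower E m)%:R :> R by [].
  by move=> /le_lt_trans /(_ tn); rewrite ltr0z.
rewrite -!pmulrn ltr_nat in tn *.
have [p pp /andP[np pn]] := gap m n m0 (ltnW tn).
have [q pq /andP[pq' qp]] := gap m p m0 (ltnW (ltn_trans tn np)).
have n0 : 0 < n%:R :> R by rewrite ltr0n (ltn_trans t0).
have npR : n%:R < p%:R :> R by rewrite ltr_nat.
have pqR : p%:R < q%:R :> R by rewrite ltr_nat.
have pnR : 4 * m%:R * p%:R <= (4 * m%:R + 1) * n%:R :> R.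
  by move: pn; rewrite -(ler_nat R) !natrM natrD natrM.
have qpR : 4 * m%:R * q%:R <= (4 * m%:R + 1) * p%:R :> R.
  by move: qp; rewrite -(ler_nat R) !natrM natrD natrM.
have low : (k - 1) / k * n%:R < n%:R.
  by rewrite mulrAC ltr_pdivrMr; [nra|lra].
have up : q%:R < k / (k - 1) * n%:R.
  rewrite mulrAC ltr_pdivlMr; last by lra.
  pose x : R := (4 * m%:R)^-1.
  have m4 : 0 < 4 * m%:R :> R by lra.
  have xE : x * (4 * m%:R) = 1 by rewrite mulVf // gt_eqF.
  have x0 : 0 < x by rewrite invr_gt0.
  have px : p%:R <= (1 + x) * n%:R.
    rewrite -(ler_pM2l m4); apply: (le_trans pnR).
    by rewrite mulrA mulrDr mulr1 [_ * x]mulrC xE.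
  have qx : q%:R <= (1 + x) * p%:R.
    rewrite -(ler_pM2l m4); apply: (le_trans qpR).
    by rewrite mulrA mulrDr mulr1 [_ * x]mulrC xE.
  have qn : q%:R <= (1 + 3 * x) * n%:R.
    have x1 : x <= 1 by nra.
    apply: (le_trans qx); apply: (le_trans (_ : _ <= (1 + x) * ((1 + x) * n%:R))).
      by rewrite ler_pM2l //; lra.
    by rewrite mulrA ler_pM2r //; nra.
  have kx : 3 * x * (k - 1) < 1 by nra.
  apply: (le_lt_trans (_ : _ <= (1 + 3 * x) * n%:R * (k - 1))).
    by rewrite ler_pM2r //; lra.
  have -> : (1 + 3 * x) * n%:R * (k - 1) = (k - 1 + 3 * x * (k - 1)) * n%:R by ring.
  by rewrite ltr_pM2r //; lra.
exists p, q; split => //.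
- by move=> pqE; rewrite pqE ltxx in pqR.
- by rewrite (lt_trans low npR) (lt_trans pqR up).
- by rewrite (lt_trans low (lt_trans npR pqR)).
Qed.
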